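(* Let $\Gamma=(V,E)$ be a finite graph with $|V|\ge 2$ such that there are no two distinct vertices $x,y\in V$ with $lk(x)\subset st(y)$. Then the right angled Artin group $R_\Gamma$ admits infinitely many linearly independent homogeneous Aut-invariant quasimorphisms.
   Context: A finite graph $\Gamma=(V,E)$ consists of a non-empty finite vertex set $V$ and a set $E$ of 2-element subsets of $V$ (no loops, no multiple edges). For $v\in V$, $lk(v)=\{x\in V:\{v,x\}\in E\}$ and $st(v)=lk(v)\cup\{v\}$. The right angled Artin group $R_\Gamma$ is the group generated by $V$ subject to the relations $xy=yx$ for all $\{x,y\}\in E$. A quasimorphism on a group $G$ is a map $\psi\colon G\to\mathbb{R}$ with $\sup_{g,h\in G}|\psi(g)+\psi(h)-\psi(gh)|<\infty$; it is homogeneous if $\psi(g^n)=n\psi(g)$ for all $g\in G,n\in\mathbb{Z}$, and Aut-invariant if $\psi\circ\varphi=\psi$ for every automorphism $\varphi$ of $G$. Linear independence refers to the real vector space of functions $G\to\mathbb{R}$. *)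

(* Defs.v *)
From Stdlib Require Import Reals Relations.
From mathcomp Require Import all_boot.
Set Implicit Arguments. Unset Strict Implicit. Unset Printing Implicit Defensive.

Local Open Scope R_scope.
Section RAAG.
Variable V : finType.

Definition simple_graph (e : rel V) : Prop :=
  symmetric e /\ irreflexive e.

Definition lk (e : rel V) (v : V) : {set V} := [set x | e v x].
Definition st (e : rel V) (v : V) : {set V} := v |: lk e v.

(** Words in the generators V and their inverses: (x, false) = x, (x, true) = x^-1. *)
Definition letter := (V * bool)%type.
Definition word := seq letter.

Definition inv_letter (a : letter) : letter := (a.1, ~~ a.2).
Definition inv_word (w : word) : word := rev (map inv_letter w).

Inductive raag_step (e : rel V) : word -> word -> Prop :=
| step_cancel u v a : raag_step e (u ++ [:: a; inv_letter a] ++ v) (u ++ v)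
| step_comm u v a b : e a.1 b.1 ->
    raag_step e (u ++ [:: a; b] ++ v) (u ++ [:: b; a] ++ v).

(** Two words represent the same element of R_Gamma. R_Gamma is the quotient
    of the free monoid on letters by this congruence (product = concatenation). *)
Definition raag_eq (e : rel V) : relation word :=
  clos_refl_sym_trans word (raag_step e).

(** Functions on R_Gamma = functions on words constant on classes. *)
Definition class_fun (e : rel V) (psi : word -> R) : Prop :=
  forall u v, raag_eq e u v -> psi u = psi v.

Definition quasimorphism (e : rel V) (psi : word -> R) : Prop :=
  class_fun e psi /\
  exists D : R, forall u v : word, (Rabs (psi u + psi v - psi (u ++ v)) <= D).

Definition zpow (w : word) (z : Z) : word :=
  match z with
  | Z0 => [::]
  | Zpos p => flatten (nseq (Pos.to_nat p) w)
  | Zneg p => flatten (nseq (Pos.to_nat p) (inv_word w))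
  end.

Definition homogeneous (psi : word -> R) : Prop :=
  forall (w : word) (n : Z), psi (zpow w n) = (IZR n * psi w).

(** Automorphisms of R_Gamma, represented on words: f is a homomorphism of
    R_Gamma (well-defined on classes, multiplicative up to raag_eq) having an
    inverse homomorphism g. Every automorphism of R_Gamma arises this way
    (by choosing representatives) and every such f induces one. *)
Definition raag_hom (e : rel V) (f : word -> word) : Prop :=
  (forall u v, raag_eq e u v -> raag_eq e (f u) (f v)) /\
  (forall u v, raag_eq e (f (u ++ v)) (f u ++ f v)).

Definition raag_aut (e : rel V) (f : word -> word) : Prop :=
  raag_hom e f /\
  exists g, raag_hom e g /\
    (forall w, raag_eq e (g (f w)) w) /\ (forall w, raag_eq e (f (g w)) w).

Definition aut_invariant (e : rel V) (psi : word -> R) : Prop :=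
  forall f, raag_aut e f -> forall w, psi (f w) = psi w.

Definition lin_indep_seq (F : nat -> word -> R) : Prop :=
  forall (n : nat) (c : nat -> R),
    (forall w, \big[Rplus/0]_(i < n) (c i * F i w) = 0) ->
    forall i, (i < n)%N -> c i = 0.

End RAAG.

(* Main.v *)
(* A homogeneous quasimorphism of the free group <x, y> that is invariant under inverting
   x and y can be pulled back along the retraction of R_Gamma onto <x, y>, for
   non-adjacent x and y, and then summed over all such pairs. The sum is Aut-invariant as
   soon as every automorphism phi permutes these retractions up to inversions of x and y
   and inner automorphisms of <x, y>.

   On the abelianization phi is a signed permutation matrix A: if A_{p,j} <> 0, then a
   vector that commutes with the column j (as commuting elements of R_Gamma do in every
   <p, b> with b not in st(p)) is determined by its coordinates in st(p). A transversal
   of non-zero entries thus gives |st(j)| <= |st(pi j)| for a permutation pi, with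
   equality by summation; so every e_d with d in lk(pi j) commutes with the column j, that
   is, lk(pi j) is contained in the star of each vertex in the support of column j.

   Next, project R_Gamma onto the free product of <x> and the free abelian group on the
   complement of st(x). If pi v is outside st(x), then v has a neighbour u with pi u
   outside st(x); the images of u and v commute and have independent abelianizations, so
   they lie in a conjugate of the free abelian factor. Hence phi(v) becomes a conjugate of
   y^(+-1) or trivial in <x, y>, and surjectivity forces a common conjugator.

   The quasimorphisms on <x, y> count, in the sequence of absolute values of syllable
   exponents, adjacent pairs (y^1, x^N) minus adjacent pairs (x^N, y^1). *)

Require Import Defs.
From HB Require Import structures.
From Stdlib Require Import Reals Lra Relations.
From mathcomp Require Import all_boot all_order all_algebra all_fingroup.
Set Implicit Arguments. Unset Strict Implicit. Unset Printing Implicit Defensive.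
Import GRing.Theory Num.Theory.

(** * Syllable words and free products *)

Section SyllableWords.
Variables (I : eqType) (M : zmodType).
Implicit Types (s t : I * M) (u v w : seq (I * M)).

Definition reduced w :=
  all (fun s => s.2 != 0%R) w && sorted (fun s t => s.1 != t.1) w.

Definition push s w :=
  if s.2 == 0%R then w else
  if w is t :: w' then
    if s.1 == t.1 then
      if (s.2 + t.2 == 0)%R then w' else (s.1, (s.2 + t.2)%R) :: w'
    else s :: w
  else [:: s].

Definition mulw u v := foldr push v u.
Definition invs s : I * M := (s.1, (- s.2)%R).
Definition invw u := rev (map invs u).

Lemma reduced_cons s w :
  reduced (s :: w) =
    [&& s.2 != 0%R, (if w is t :: _ then s.1 != t.1 else true) & reduced w].
Proof. by case: w => [|t w]; rewrite /reduced /= ?andbT // -!andbA; do !bool_congr. Qed.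

Lemma reduced_cat_cons u s v :
  reduced (u ++ s :: v) = reduced (rcons u s) && reduced (s :: v).
Proof.
elim: u => [|t u IH] /=; first by rewrite !reduced_cons /= andbT; case: (s.2 != _).
by rewrite !(reduced_cons t) IH; case: u {IH} => [|t' u] /=; rewrite -!andbA.
Qed.

Lemma reduced_catP u v : reduced (u ++ v) -> reduced u /\ reduced v.
Proof.
rewrite /reduced all_cat => /andP[/andP[-> ->] /=].
by case: u => [|s u] //=; rewrite cat_path => /andP[-> ] /path_sorted ->.
Qed.

Lemma reduced_rcons2 u s t :
  reduced (rcons (rcons u s) t) = [&& reduced (rcons u s), t.2 != 0%R & s.1 != t.1].
Proof.
rewrite -!cats1 -catA /= reduced_cat_cons cats1 !reduced_cons /= andbT.
case E: (reduced (rcons u s)) => //=; move: E.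
by rewrite /reduced all_rcons => /andP[/andP[-> _] _] /=; rewrite andbC.
Qed.

Lemma reduced_cat u v : reduced u -> reduced v ->
  (forall s t u' v', u = rcons u' s -> v = t :: v' -> s.1 != t.1) -> reduced (u ++ v).
Proof.
case: v => [|t v]; first by rewrite cats0.
move=> ru rv H; rewrite reduced_cat_cons rv andbT.
case: (lastP u) ru H => [_ _|u' s ru H].
  by move: rv; rewrite reduced_cons => /and3P[ht _ _]; rewrite reduced_cons /= ht.
rewrite reduced_rcons2 ru (H s t u' v) // andbT.
by move: rv; rewrite reduced_cons => /and3P[].
Qed.

Lemma reduced_push s w : reduced w -> reduced (push s w).
Proof.
rewrite /push; case: eqP => // /eqP s0 rw; case: w rw => [_|t w rw].
  by rewrite reduced_cons s0.
move: (rw); rewrite reduced_cons => /and3P[t0 hw rw'].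
case: eqP => [est|/eqP nst]; last by rewrite reduced_cons s0 nst.
by case: eqP => // /eqP st0; rewrite reduced_cons /= st0 est hw.
Qed.

Lemma reduced_mulw u v : reduced v -> reduced (mulw u v).
Proof. by move=> rv; elim: u => //= s u; apply: reduced_push. Qed.

Lemma push0 i w : push (i, 0%R) w = w.
Proof. by rewrite /push eqxx. Qed.

Lemma push_red s w : reduced (s :: w) -> push s w = s :: w.
Proof.
rewrite reduced_cons /push => /and3P[/negPf-> h _].
by case: w h => // t w /negPf->.
Qed.

(** Each copy of [M] acts on reduced words by [push]; associativity of [mulw] and the inverse laws
    rest on this. *)
Lemma pushD i m n w : reduced w -> push (i, m) (push (i, n) w) = push (i, (m + n)%R) w.
Proof.
have [->|m0] := eqVneq m 0%R; first by rewrite push0 add0r.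
have [->|n0] := eqVneq n 0%R; first by rewrite push0 addr0.
case: w => [_|[j p] w rw].
  by rewrite /push /= (negPf m0) (negPf n0) eqxx.
rewrite {2}/push /= (negPf n0).
have [eij|nij] := eqVneq i j; last first.
  rewrite /push /= (negPf m0) eqxx (negPf nij); case: eqP => // _.
rewrite -eij in rw *.
have [np|np] := eqVneq (n + p)%R 0%R.
  have -> : n = (- p)%R by apply/eqP; rewrite -addr_eq0 np.
  have [mp|mp] := eqVneq m p.
    by rewrite mp subrr push0 push_red.
  rewrite {2}/push /= subr_eq0 (negPf mp) eqxx subrK (negPf m0).
  apply: push_red; move: rw; rewrite !reduced_cons /= m0.
  by case/and3P=> _ -> ->.
rewrite {1}/push /= (negPf m0) eqxx addrA /push /=.
case: (eqVneq (m + n) 0)%R => [->|mn]; rewrite ?eqxx ?add0r //.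
move: rw; rewrite reduced_cons => /and3P[/negPf /= p0 _ _].
by rewrite p0.
Qed.

Lemma mulw_push s u w : reduced u -> reduced w -> mulw (push s u) w = push s (mulw u w).
Proof.
move=> ru rw; case: s => i m.
have [->|m0] := eqVneq m 0%R; first by rewrite !push0.
case: u ru => [|[j n] u] ru; first by rewrite {1}/push /= (negPf m0).
rewrite {1}/push /= (negPf m0); have [eij|nij //] := eqVneq i j.
rewrite -eij pushD ?reduced_mulw //.
by have [->|mn //] := eqVneq (m + n)%R 0%R; rewrite push0.
Qed.

Lemma mulwA u v w : reduced v -> reduced w -> mulw u (mulw v w) = mulw (mulw u v) w.
Proof. by move=> rv rw; elim: u => //= s u ->; rewrite mulw_push ?reduced_mulw. Qed.

Lemma mulw_cat u v : reduced (u ++ v) -> mulw u v = u ++ v.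
Proof.
elim: u => //= s u IH r.
have r' : reduced (u ++ v) by move: r; rewrite reduced_cons => /and3P[].
by rewrite (IH r') push_red.
Qed.

Lemma mulw0 u : reduced u -> mulw u [::] = u.
Proof. by move=> ru; rewrite mulw_cat cats0. Qed.

Lemma invwK : involutive invw.
Proof.
move=> u; rewrite /invw map_rev revK -map_comp map_id_in // => -[i m] _.
by rewrite /invs /= opprK.
Qed.

Lemma invw_cons s u : invw (s :: u) = rcons (invw u) (invs s).
Proof. by rewrite /invw /= rev_cons. Qed.

Lemma invw_rcons u s : invw (rcons u s) = invs s :: invw u.
Proof. by rewrite /invw map_rcons rev_rcons. Qed.

Lemma size_invw u : size (invw u) = size u.
Proof. by rewrite size_rev size_map. Qed.

Lemma reduced_invw u : reduced u -> reduced (invw u).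
Proof.
rewrite /reduced /invw => /andP[h1 h2]; rewrite all_rev all_map rev_sorted sorted_map.
apply/andP; split; first by apply: sub_all h1 => s /=; rewrite oppr_eq0.
by apply: sub_sorted h2 => s t /=; rewrite eq_sym.
Qed.

Lemma mulw_rcons u s v : mulw (rcons u s) v = mulw u (push s v).
Proof. by rewrite /mulw foldr_rcons. Qed.

Lemma mulVw u : reduced u -> mulw (invw u) u = [::].
Proof.
elim: u => //= s u IH ru; have ru' : reduced u by move: ru; rewrite reduced_cons => /and3P[].
rewrite invw_cons mulw_rcons -(push_red ru); case: s {ru} => i m.
by rewrite pushD // addNr push0 IH.
Qed.

Lemma size_push s w : size (push s w) <= (size w).+1.
Proof.
rewrite /push; case: ifP => // _; case: w => //= t w.
by case: ifP => // _; case: ifP => //= _; rewrite ltnW.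
Qed.

Lemma size_mulw u v : size (mulw u v) <= size u + size v.
Proof.
by elim: u => //= s u IH; rewrite (leq_trans (size_push _ _)) // ltnS.
Qed.

Lemma push_size_eq s w : size (push s w) = (size w).+1 -> push s w = s :: w.
Proof.
rewrite /push; case: ifP => _; first by move/eqP; rewrite eqn_leq ltnn andbF.
case: w => //= t w; case: ifP => // _; case: ifP => _ /= /eqP.
  by rewrite eqn_leq ltnNge leqnSn andbF.
by rewrite eqSS eqn_leq ltnn andbF.
Qed.

Lemma mulw_size_eq u v : size (mulw u v) = size u + size v -> mulw u v = u ++ v.
Proof.
elim: u => //= s u IH E.
have E' : size (mulw u v) = size u + size v.
  apply/eqP; rewrite eqn_leq size_mulw /= -ltnS -addSn -E.
  exact: size_push.
by rewrite push_size_eq ?(IH E') // -(IH E') E E'.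
Qed.

(** All cancellation happens at the junction: a suffix [c] of [u] meets its inverse in [v], after
    which at most one pair of syllables merges. This bounds the defect of counting functions. *)
Lemma mulw_decomp u v : reduced u -> reduced v -> exists u' c v',
  [/\ u = u' ++ c, v = invw c ++ v' & mulw u v = u' ++ v'] \/
  exists i m n, [/\ u = u' ++ (i, m) :: c, v = invw c ++ (i, n) :: v' &
                    mulw u v = u' ++ (i, (m + n)%R) :: v'].
Proof.
elim/last_ind: u v => [|u [i m] IH] v ru rv.
  by exists [::], [::], v; left.
have ru' : reduced u by move: ru; rewrite -cats1 => /reduced_catP[].
case: v rv => [|[j n] v] rv.
  by exists (rcons u (i, m)), [::], [::]; left; split; rewrite ?cats0 ?mulw0.
have m0 : m != 0%R by move: ru; rewrite /reduced all_rcons => /andP[/andP[]].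
have [eij|nij] := eqVneq i j; last first.
  exists (rcons u (i, m)), [::], ((j, n) :: v); left; split; rewrite ?cats0 //.
  rewrite mulw_cat //; apply: reduced_cat => // s t u1 v1 /rcons_inj[_ <-] [<- _] //.
rewrite -{j}eij in rv *.
have rv' : reduced v by move: rv; rewrite reduced_cons => /and3P[].
have [mn|mn] := eqVneq (m + n)%R 0%R.
  have [u' [c [v' H]]] := IH v ru' rv'.
  have E : mulw (rcons u (i, m)) ((i, n) :: v) = mulw u v.
    by rewrite mulw_rcons /push /= eqxx mn eqxx (negPf m0).
  have Ec : (i, n) = invs (i, m) :> I * M.
    by rewrite /invs /=; congr pair; apply/eqP; rewrite -addr_eq0 addrC mn.
  exists u', (rcons c (i, m)), v'; rewrite E invw_rcons /= -Ec.
  case: H => [[-> -> ->]|[j [p [q [-> -> ->]]]]]; [left|right; exists j, p, q];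
    by split; rewrite // rcons_cat.
exists u, [::], v; right; exists i, m, n; split; rewrite ?cats1 //.
rewrite mulw_rcons /push /= (negPf m0) eqxx (negPf mn) mulw_cat //.
rewrite reduced_cat_cons; apply/andP; split.
  case: (lastP u) ru => [_|w s]; first by rewrite reduced_cons /= mn.
  by rewrite !reduced_rcons2 /= => /and3P[-> _ ->]; rewrite mn.
by move: rv; rewrite !reduced_cons /= mn => /and3P[_ -> ->].
Qed.

End SyllableWords.

(** Commuting words are powers of a common word, so their sums are proportional to their lengths.
    The Euclidean algorithm on the lengths shows this without exhibiting the common root. *)
Lemma cat_comm_sum (T : Type) (M : zmodType) (F : T -> M) (u v : seq T) :
  u ++ v = v ++ u ->
  ((\sum_(s <- u) F s) *+ size v = (\sum_(s <- v) F s) *+ size u)%R.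
Proof.
have [n] := ubnP (size u + size v); elim: n u v => // n IH u v.
wlog luv : u v / size u <= size v => [H|].
  case/orP: (leq_total (size u) (size v)) => [/H //|/H{}H ltn E].
  by apply/esym/H; rewrite // addnC.
case: u luv => [|a u] luv ltn E; first by rewrite big_nil mul0rn mulr0n.
have Ev : v = (a :: u) ++ drop (size (a :: u)) v.
  have := congr1 (take (size (a :: u))) E.
  rewrite take_size_cat // takel_cat // => Et.
  by rewrite -[LHS](cat_take_drop (size (a :: u))) -Et.
set u' := a :: u in luv ltn E Ev *; set v' := drop _ v in Ev.
have E' : u' ++ v' = v' ++ u'.
  by have := congr1 (drop (size u')) E; rewrite {2}Ev -catA !drop_size_cat // -Ev.
have := IH u' v'; rewrite E' => /(_ _ erefl) H.
rewrite Ev big_cat size_cat /= mulrnDl mulrnDr H //.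
move: ltn; rewrite {1}Ev size_cat /u' /= !addSn ltnS => ltn.
by apply: leq_ltn_trans ltn; rewrite addnS ltnS leq_addl.
Qed.

(** * The free product of copies of [M] indexed by [I], as the group of reduced words *)

Section FreeProduct.
Variables (I : choiceType) (M : zmodType).

Record fprod := FProd { fpval :> seq (I * M); fpvalP : reduced fpval }.

HB.instance Definition _ := [isSub for fpval].
HB.instance Definition _ := [Choice of fprod by <:].

Definition fp_one := @FProd [::] isT.
Definition fp_mul (g h : fprod) := FProd (reduced_mulw g (fpvalP h)).
Definition fp_inv (g : fprod) := FProd (reduced_invw (fpvalP g)).

Lemma fp_mulA : associative fp_mul.
Proof. by move=> g h k; apply/val_inj/mulwA; apply: fpvalP. Qed.

Lemma fp_mul1 : left_id fp_one fp_mul.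
Proof. by move=> g; apply: val_inj. Qed.

Lemma fp_mul1r : right_id fp_one fp_mul.
Proof. by move=> g; apply/val_inj/mulw0/fpvalP. Qed.

Lemma fp_mulV : left_inverse fp_one fp_inv fp_mul.
Proof. by move=> g; apply/val_inj/mulVw/fpvalP. Qed.

Lemma fp_mulrV : right_inverse fp_one fp_inv fp_mul.
Proof.
move=> g; apply: val_inj; rewrite /= -{1}[fpval g]invwK.
exact/mulVw/reduced_invw/fpvalP.
Qed.

HB.instance Definition _ :=
  isGroup.Build fprod fp_mulA fp_mul1 fp_mul1r fp_mulV fp_mulrV.

Local Open Scope group_scope.
Implicit Types g h k : fprod.

Lemma fpvalM g h : g * h = mulw g h :> seq _. Proof. by []. Qed.
Lemma fpvalV g : g^-1 = invw g :> seq _. Proof. by []. Qed.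

Definition syl i m : fprod := FProd (reduced_push (i, m) (isT : reduced [::])).

Lemma fpval_syl i m : syl i m = (if m == 0%R then [::] else [:: (i, m)]) :> seq _.
Proof. by []. Qed.

Lemma syl0 i : syl i 0%R = 1.
Proof. by apply: val_inj; rewrite /= push0. Qed.

Lemma fpval_sylM i m g : syl i m * g = push (i, m) g :> seq _.
Proof.
by rewrite fpvalM fpval_syl; case: eqP => // ->; rewrite push0.
Qed.

Lemma sylD i m n : syl i (m + n)%R = syl i m * syl i n.
Proof. by apply: val_inj; rewrite [RHS]fpval_sylM pushD. Qed.

Lemma sylN i m : syl i (- m)%R = (syl i m)^-1.
Proof. by apply/esym/mulg1_eq; rewrite -sylD subrr syl0. Qed.

Lemma sylC i m n : commute (syl i m) (syl i n).
Proof. by rewrite /commute -!sylD addrC. Qed.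

Lemma sylX i m n : syl i (m *+ n)%R = syl i m ^+ n.
Proof. by elim: n => [|n IH]; rewrite ?syl0 // mulrS sylD IH expgS. Qed.

Lemma reduced_behead (s : I * M) w : reduced (s :: w) -> reduced w.
Proof. by rewrite reduced_cons => /and3P[]. Qed.

Lemma fprod_cons s w (r : reduced (s :: w)) :
  FProd r = syl s.1 s.2 * FProd (reduced_behead r).
Proof. by apply: val_inj; rewrite [RHS]fpval_sylM -surjective_pairing /= push_red. Qed.

Lemma fprod_ind (P : fprod -> Prop) :
  P 1 -> (forall i m g, P g -> P (syl i m * g)) -> forall g, P g.
Proof.
move=> P1 PM [w r]; elim: w r => [|s w IH] r.
  by rewrite (_ : FProd r = 1) //; apply: val_inj.
by rewrite fprod_cons; apply: PM.
Qed.

Section Lift.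
Variables (G : groupType) (phi : I -> M -> G).
Hypothesis phiD : forall i m n, phi i (m + n)%R = phi i m * phi i n.

Lemma phi0 i : phi i 0%R = 1.
Proof. by apply: (mulgI (phi i 0%R)); rewrite -phiD mulg1 addr0. Qed.

Definition liftw (w : seq (I * M)) := \prod_(s <- w) phi s.1 s.2.

Lemma liftw_push s w : liftw (push s w) = phi s.1 s.2 * liftw w.
Proof.
rewrite /push; case: s => i m /=; case: eqP => [->|_]; first by rewrite phi0 mul1g.
case: w => [|[j n] w]; first by rewrite /liftw big_cons.
case: eqP => /= [eij|_]; last by rewrite {1}/liftw big_cons.
rewrite {2}/liftw big_cons /= mulgA -eij -phiD.
by case: eqP => [->|_]; rewrite ?phi0 ?mul1g // /liftw big_cons.
Qed.

(** The homomorphism provided by the universal property of the free product. *)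
Definition lift_fp g := liftw g.

Lemma lift_fpM g h : lift_fp (g * h) = lift_fp g * lift_fp h.
Proof.
rewrite /lift_fp fpvalM; elim: (fpval g) => [|s w IH] /=.
  by rewrite /liftw big_nil mul1g.
by rewrite liftw_push IH mulgA /liftw big_cons.
Qed.

Lemma lift_fp1 : lift_fp 1 = 1.
Proof. by rewrite /lift_fp /liftw big_nil. Qed.

Lemma lift_syl i m : lift_fp (syl i m) = phi i m.
Proof. by rewrite /lift_fp liftw_push /liftw big_nil mulg1. Qed.

End Lift.

(** As [M] is abelian, this is the projection of the free product onto its factor [i]. *)
Definition abel i g : M := (\sum_(s <- fpval g | s.1 == i) s.2)%R.

Lemma abel_push i s (w : seq (I * M)) :
  (\sum_(t <- push s w | t.1 == i) t.2 =
   (if s.1 == i then s.2 else 0) + \sum_(t <- w | t.1 == i) t.2)%R.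
Proof.
rewrite /push; case: s => j m /=; case: eqP => [->|_].
  by rewrite if_same add0r.
case: w => [|[k n] w] /=.
  by rewrite big_cons /= !big_nil; case: eqP => _; rewrite ?addr0.
rewrite [in RHS]big_cons /=; have [->|_] := eqVneq j k; last first.
  by rewrite !big_cons /=; case: (j == i) => /=; rewrite ?add0r.
case: eqP => [mn|_]; last by rewrite big_cons /=; case: (k == i); rewrite ?addrA ?add0r.
by case: (k == i); rewrite ?add0r // addrA mn add0r.
Qed.

Lemma abelM i g h : abel i (g * h) = (abel i g + abel i h)%R.
Proof.
rewrite /abel fpvalM; elim: (fpval g) => [|s w IH] /=; first by rewrite big_nil add0r.
by rewrite abel_push IH big_cons; case: eqP => _; rewrite ?addrA ?add0r.
Qed.

Lemma abel1 i : abel i 1 = 0%R.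
Proof. by rewrite /abel big_nil. Qed.

Lemma abelV i g : abel i g^-1 = (- abel i g)%R.
Proof. by apply/eqP; rewrite -addr_eq0 -abelM mulVg abel1. Qed.

Lemma abel_syl i j m : abel i (syl j m) = (if j == i then m else 0)%R.
Proof. by rewrite /abel abel_push big_nil addr0. Qed.

Lemma abelJ i g k : abel i (g ^ k) = abel i g.
Proof. by rewrite conjgE !abelM abelV addrC -addrA subrr addr0. Qed.

Lemma fpval_size1 g : size g <= 1 -> g != 1 -> exists i m, m != 0%R /\ g = syl i m.
Proof.
case: g => [[|[i m] [|s w]] r] // _ _.
exists i, m; have m0 : m != 0%R by move: r; rewrite reduced_cons => /and3P[].
by split=> //; apply: val_inj; rewrite /= /push /= (negPf m0).
Qed.

(** A leading syllable in the factor [i] commutes with [syl i m] and can be split off. If the rest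
    [t] were non-empty, [syl i m * t] would begin in the factor [i], whereas [t * syl i m], of the
    same length and hence free of cancellation, would begin as [t] does. *)
Lemma cent_syl i m h : m != 0%R -> commute (syl i m) h -> exists n, h = syl i n.
Proof.
have H (t : fprod) : (if fpval t is s :: _ then s.1 != i else true) ->
    m != 0%R -> commute (syl i m) t -> t = 1.
  move=> ht m0 c; apply: val_inj => /=.
  have E1 : syl i m * t = (i, m) :: t :> seq _.
    rewrite fpval_sylM push_red // reduced_cons m0 fpvalP /= andbT.
    by case: (fpval t) ht => // s w; rewrite eq_sym.
  have E2 : t * syl i m = t ++ [:: (i, m)] :> seq _.
    have Es : fpval (syl i m) = [:: (i, m)] by rewrite fpval_syl (negPf m0).
    rewrite fpvalM Es; apply: mulw_size_eq.
    by rewrite -{1}Es -fpvalM -c E1 /= addn1.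
  have : (i, m) :: fpval t = fpval t ++ [:: (i, m)] by rewrite -E1 -E2 c.
  by case: (fpval t) ht => // s w /= /[swap] -[<- _]; rewrite eqxx.
move=> m0 c; case: h c => [[|[j n] w] r] c; first by exists 0%R; rewrite syl0; apply: val_inj.
have [eji|nji] := eqVneq j i; last first.
  by exists 0%R; rewrite syl0; apply: H c.
subst j; rewrite fprod_cons /= in c *; set t := FProd _ in c *.
have -> : t = 1.
  apply: H m0 _.
    by move: (r); rewrite /= reduced_cons; case: (w) => //= s w' /and3P[_]; rewrite eq_sym.
  have := commuteM (commuteV (sylC i m n)) c.
  by rewrite mulKg.
by exists n; rewrite mulg1.
Qed.

Definition cyc_reduced (w : seq (I * M)) :=
  if w is s :: w' then (w' == [::]) || (s.1 != (last s w').1) else true.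

Lemma conj_cyc_reduced g : exists k h, g = h ^ k /\ cyc_reduced h.
Proof.
have [n] := ubnP (size g); elim: n g => // n IH g ltn.
case: (boolP (cyc_reduced g)) => [|nc]; first by exists 1, g; rewrite conjg1.
case: g ltn nc => [[|s w'] r] //=; case: (lastP w') r => [|w t] // r.
rewrite ltnS size_rcons last_rcons negb_or negbK => ltn /andP[_ /eqP est].
have r' := reduced_behead r.
have rw : reduced w by move: r'; rewrite -cats1 => /reduced_catP[].
(* Conjugation moves the first syllable [s] to the end, where it merges with [t]; the word gets
   shorter. *)
pose h := FProd rw * syl s.1 (t.2 + s.2)%R.
have [|k [h' [Eh ch]]] := IH h.
  apply: leq_ltn_trans (size_mulw _ _) _; apply: leq_ltn_trans ltn.
  by rewrite -addn1 leq_add2l /=; apply: leq_trans (size_push _ _) _.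
exists (k * syl s.1 (- s.2)%R), h'; split => //.
rewrite conjgM -Eh fprod_cons; apply: (conjg_inj (syl s.1 s.2)).
rewrite -conjgM -sylD addNr syl0 conjg1 conjgE mulgA mulKg /h sylD mulgA.
congr (_ * _); apply: val_inj; rewrite /= /push /=.
have t0 : t.2 != 0%R by case/andP: r' => /allP/(_ t) + _; apply; rewrite mem_rcons mem_head.
by rewrite (negPf t0) est -surjective_pairing mulw_cat cats1.
Qed.

Lemma commute_conj g h k : commute g h -> commute (g ^ k) (h ^ k).
Proof. by rewrite /commute -!conjMg => ->. Qed.

Lemma abel_sum_cat (u w : seq (I * M)) i : u ++ w = w ++ u ->
  ((\sum_(s <- u | s.1 == i) s.2) *+ size w = (\sum_(s <- w | s.1 == i) s.2) *+ size u)%R.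
Proof. by move=> /(cat_comm_sum (fun s => if s.1 == i then s.2 else 0)%R); rewrite -!big_mkcond. Qed.

(* When g is cyclically reduced of length at least two, one of the products h g
   and h g^-1 is free of cancellation; comparing lengths, so is g^(+-1) h, and the two
   syllable words commute in the free monoid. *)
Lemma commute_trichotomy g h : commute g h -> g != 1 ->
  (exists k i m n, [/\ m != 0%R, g = syl i m ^ k & h = syl i n ^ k]) \/
  exists (a : nat) (b : int), 0 < a /\ forall i, (abel i h *+ a = abel i g *~ b)%R.
Proof.
have [k [u [-> cu]]] := conj_cyc_reduced g => c.
rewrite conjg_eq1 => u1.
have {c} c : commute u (h ^ k^-1) by rewrite -[u](conjgK k); apply: commute_conj.
move: (conjgKV k h); move: (h ^ k^-1) c => w c <-.
have [su|su] := leqP (size u) 1.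
  left; have [i [m [m0 Eu]]] := fpval_size1 su u1.
  rewrite Eu in c *; have [n ->] := cent_syl m0 c.
  by exists k, i, m, n.
right; case: (boolP (w == 1)) => [/eqP->|w1].
  by exists 1%N, 0%R; split=> // i; rewrite conj1g abel1 mulr0z mul0rn.
have key (v : fprod) : commute v w -> size v = size u ->
    (forall s t v' w', fpval w = rcons w' s -> fpval v = t :: v' -> s.1 != t.1) ->
    forall i, (abel i w *+ size u = abel i v *+ size w)%R.
  move=> cv sv nc i.
  have E1 : w * v = w ++ v :> seq _.
    by rewrite fpvalM mulw_cat //; apply: reduced_cat (fpvalP _) (fpvalP _) _ => s t w' v'; apply: nc.
  have E2 : v * w = v ++ w :> seq _.
    by rewrite fpvalM mulw_size_eq // -fpvalM cv E1 size_cat addnC.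
  have E : fpval v ++ fpval w = fpval w ++ fpval v by rewrite -E1 -E2 cv.
  by rewrite /abel -sv; apply/esym/abel_sum_cat.
exists (size u); case: u cu u1 c su key => [[|s u'] r] // cu u1 c su key.
case: (lastP u') r cu u1 c su key => [|v t] // r; rewrite /= last_rcons => cu u1 c su key.
have {}cu : s.1 != t.1 by case: (v) cu.
have [w2 [l Ew]] : exists w2 l, fpval w = rcons w2 l.
  case/lastP E: (fpval w) => [|w2 l]; last by exists w2, l.
  by case/eqP: w1; apply: val_inj.
have [els|nls] := eqVneq l.1 s.1.
  exists (- Posz (size w))%R; split=> // i; rewrite !abelJ.
  have -> := key _ (commute_sym (commuteV (commute_sym c))).
  - by rewrite abelV mulNrn mulrNz.
  - by rewrite fpvalV size_invw.
  move=> s' t' v' w3; rewrite Ew fpvalV /= -rcons_cons invw_rcons => /rcons_inj[_ <-] [<- _].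
  by rewrite els.
exists (Posz (size w)); split=> // i; rewrite !abelJ.
have -> := key _ c erefl; first by rewrite pmulrn.
by move=> s' t' v' w3; rewrite Ew => /rcons_inj[_ <-] [<- _].
Qed.

End FreeProduct.

(** * Conjugates of two factors that generate their free product *)

Section ConjugatedFactors.
Local Open Scope group_scope.
Variable M : zmodType.
Local Notation FP := (fprod bool M).

(** For such [P] the product [P * syl false b * P^-1] is reduced and has both ends in the factor
    [false], so alternating products with syllables [syl true a] do not cancel. *)
Definition bridging (w : seq (bool * M)) :=
  if w is s :: w' then (s.1 == false) && (last s w').1 else false.

Section Span.
Variable P : FP.
Hypothesis Phead : bridging P.

(* The elements of the subgroup generated by the factor [true] and the conjugate of
   the factor [false] by P, in normal form; the index is the factor of the first syllable. *)
Inductive conj_span : bool -> FP -> Prop :=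
| span1 i : conj_span i 1
| spanF b h : b != 0%R -> conj_span true h -> conj_span false (P * syl false b * P^-1 * h)
| spanT a g : a != 0%R -> conj_span false g -> conj_span true (syl true a * g).

(** The blocks of a normal form are simply concatenated. With index [false] the word begins with all
    of [P], so it has more than one syllable. *)
Lemma conj_span_head i g : conj_span i g ->
  if fpval g is s :: w then (s.1 == i) && (i || (w != [::])) else true.
Proof.
elim=> {i g} [i //|b h b0 _ IH|a g a0 _ IH]; last first.
  rewrite fpval_sylM push_red // reduced_cons a0 fpvalP /= andbT.
  by case: (fpval g) IH => // s w /andP[/eqP->].
have -> : fpval (P * syl false b * P^-1 * h) = fpval P ++ (false, b) :: (invw P ++ h); last first.
  by case: (fpval P) Phead => // s w /= /andP[-> _] /=; case: w.
have rP := fpvalP P; have rh := fpvalP h.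
have rq : reduced (invw P ++ h).
  apply: reduced_cat => // [|s t u v]; first exact: reduced_invw.
  case: (fpval P) Phead => // p w /andP[/eqP ep _]; rewrite invw_cons => /rcons_inj[_ <-] Eh.
  by move: IH; rewrite Eh => /andP[/eqP-> _]; rewrite /= ep.
have rbq : reduced ((false, b) :: (invw P ++ h)).
  rewrite reduced_cons b0 rq andbT /=.
  case/lastP: (fpval P) Phead => // w t; rewrite invw_rcons /=.
  by case: w => [|s w] /=; rewrite ?last_rcons => /andP[_ ->].
rewrite -!mulgA fpvalM fpval_sylM fpvalM fpvalV mulw_cat // push_red // mulw_cat //.
apply: reduced_cat => // s t u v EP [<- _].
by move: Phead; rewrite EP; case: u {EP} => [|r u] /=; rewrite ?last_rcons => /andP[_ ->].
Qed.

Lemma conj_span_mulT i n g : conj_span i g -> exists j, conj_span j (syl true n * g).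
Proof.
have [->|n0] := eqVneq n 0%R; first by rewrite syl0 mul1g; exists i.
case=> {i g} [_|b h b0 hh|a g a0 hg].
- by exists true; apply: spanT n0 (span1 _).
- by exists true; apply: spanT n0 (spanF b0 hh).
rewrite mulgA -sylD; have [->|na] := eqVneq (n + a)%R 0%R.
  by exists false; rewrite syl0 mul1g.
by exists true; apply: spanT.
Qed.

Lemma conj_span_mulF i n g : conj_span i g -> exists j, conj_span j (P * syl false n * P^-1 * g).
Proof.
have [->|n0] := eqVneq n 0%R; first by rewrite syl0 mulg1 mulgV mul1g; exists i.
case=> {i g} [_|b h b0 hh|a g a0 hg].
- by exists false; apply: spanF n0 (span1 _).
- rewrite !mulgA mulgVK -(mulgA P) -sylD; have [->|nb] := eqVneq (n + b)%R 0%R.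
    by exists true; rewrite syl0 mulg1 mulgV mul1g.
  by exists false; apply: spanF.
- by exists false; apply: spanF n0 (spanT a0 hg).
Qed.

End Span.

(** The outer syllables can be absorbed into the conjugators later, since each commutes with the
    factor it belongs to; what remains is trivial or bridging. *)
Lemma strip_ends (z : FP) : exists a P b,
  z = syl false a * P^-1 * syl true b /\
  (if fpval P is s :: w then (s.1 == false) && (last s w).1 else true).
Proof.
have [b [y [Ez hy]]] : exists b y, z^-1 = syl true b * y /\
    (if fpval y is s :: w then s.1 == false else true).
  case: (z^-1) => [[|[[] b] w] r].
  - by exists 0%R, (FProd r); rewrite syl0 mul1g.
  - exists b, (FProd (reduced_behead r)); rewrite fprod_cons; split=> //=.
    by move: r; rewrite reduced_cons; case: w => //= -[[] m] w; rewrite ?andbF.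
  - by exists 0%R, (FProd r); rewrite syl0 mul1g.
have [a [P [Ey hP]]] : exists a P, y = P * syl false a /\
    (if fpval P is s :: w then (s.1 == false) && (last s w).1 else true).
  case: y hy {Ez} => w; case/lastP: w => [|w [j a]] r hw.
    by exists 0%R, (FProd r); rewrite syl0 mulg1.
  case: j r hw => r hw.
    exists 0%R, (FProd r); rewrite syl0 mulg1; split=> //=.
    by case: w r hw => [|s w] r //=; rewrite last_rcons => ->.
  have rw : reduced w by move: (r); rewrite -cats1 => /reduced_catP[].
  exists a, (FProd rw); split.
    apply: val_inj; rewrite [RHS]fpvalM fpval_syl.
    have -> : (a == 0)%R = false.
      by case/andP: (r) => /allP/(_ (false, a)); rewrite mem_rcons mem_head => /(_ isT)/negPf.
    by rewrite mulw_cat cats1.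
  rewrite /= in hw *; case/lastP: w {rw} r hw => // w t.
  rewrite reduced_rcons2 /= => /and3P[_ _]; case: t => -[] p // _.
  by case: w => [|s w] //=; rewrite last_rcons => ->.
exists (- a)%R, P, (- b)%R; split=> //.
by apply: invg_inj; rewrite Ez Ey !invgM invgK -!sylN !opprK mulgA.
Qed.

(* Up to conjugation k is trivial and l^-1 is bridging or trivial. If it is bridging, then
   normal forms in [conj_span] that begin with the factor [false] have more than one
   syllable, so no element of this factor is generated. *)
Lemma conj_factors_generate (k l : FP) : (exists m : M, m != 0%R) ->
  (forall g, exists w, g = \prod_(s <- w) syl s.1 s.2 ^ (if s.1 then k else l)) ->
  exists c, forall n, syl true n ^ k = syl true n ^ c /\ syl false n ^ l = syl false n ^ c.
Proof.
move=> [m m0] gen; have [a [P [b [Ez hP]]]] := strip_ends (l * k^-1).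
have conj_syl i p q : syl i p ^ syl i q = syl i p :> FP.
  by rewrite conjgE (sylC i p q) mulKg.
pose c := syl true b * k; exists c.
have kE n : syl true n ^ k = syl true n ^ c by rewrite /c conjgM conj_syl.
have lE n : syl false n ^ l = (P * syl false n * P^-1) ^ c.
  rewrite -(mulgVK k l) Ez -mulgA -/c -(mulgA (syl false a)) !conjgM conj_syl.
  by rewrite [_ ^ P^-1]conjgE invgK mulgA.
move=> n; split=> //; rewrite lE.
have [->|P1] := eqVneq P 1; first by rewrite invg1 mulg1 mul1g.
have {}hP : bridging P.
  by case: P hP P1 {Ez lE} => [[|s w] r] // _ /eqP[]; apply: val_inj.
have [w /(congr1 (fun g => g ^ c^-1))] := gen (syl false m ^ c).
rewrite conjgK conjg_prod => Em.
have [j] : exists j, conj_span P j (syl false m).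
  rewrite Em; elim: w {Em} => [|[i p] w [j IH]].
    by rewrite big_nil; exists true; apply: span1.
  rewrite big_cons; case: i => /=; rewrite ?kE ?lE conjgK.
    exact: conj_span_mulT IH.
  exact: conj_span_mulF IH.
move/(conj_span_head hP); rewrite fpval_syl (negPf m0) /=.
by case: j.
Qed.

End ConjugatedFactors.

(** * Homomorphisms from words *)

Section Evaluation.
Variables (V : finType) (e : rel V) (G : groupType).
Local Open Scope group_scope.

Definition ev (gamma : V -> G) (w : word V) : G :=
  \prod_(a <- w) (if a.2 then (gamma a.1)^-1 else gamma a.1).

Definition gen (x : V) : word V := [:: (x, false)].

Lemma ev_cat gamma u v : ev gamma (u ++ v) = ev gamma u * ev gamma v.
Proof. exact: big_cat. Qed.

Lemma ev_nil gamma : ev gamma [::] = 1.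
Proof. exact: big_nil. Qed.

Lemma ev_cons gamma a w :
  ev gamma (a :: w) = (if a.2 then (gamma a.1)^-1 else gamma a.1) * ev gamma w.
Proof. exact: big_cons. Qed.

Lemma ev_gen gamma x : ev gamma (gen x) = gamma x.
Proof. by rewrite ev_cons ev_nil mulg1. Qed.

Lemma ev_inv_word gamma w : ev gamma (inv_word w) = (ev gamma w)^-1.
Proof.
elim: w => [|[x b] w IH]; first by rewrite /inv_word /= ev_nil invg1.
rewrite /inv_word /= rev_cons -cats1 ev_cat [ev _ (rev _)]IH !ev_cons ev_nil mulg1 invgM.
by case: b => /=; rewrite ?invgK.
Qed.

Lemma ev_flatten gamma n w : ev gamma (flatten (nseq n w)) = ev gamma w ^+ n.
Proof. by elim: n => [|n IH]; rewrite ?ev_nil // /= ev_cat IH expgS. Qed.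

Lemma ev_class gamma : (forall x y, e x y -> commute (gamma x) (gamma y)) ->
  forall u v, raag_eq e u v -> ev gamma u = ev gamma v.
Proof.
move=> H u v; elim => {u v} [_ _ [u v [x b]|u v [x b] [y c] /= /H xy]|//|u v _ -> //|u v w _ -> _ ->] //.
  rewrite !ev_cat !ev_cons ev_nil mulg1 /=.
  by case: b; rewrite /= ?mulVg ?mulgV mul1g.
rewrite !ev_cat !ev_cons /= !mulgA; congr (_ * _).
rewrite -!mulgA; congr (_ * _); case: b c => [] [] //=.
- exact/commuteV/commute_sym/commuteV/commute_sym.
- exact/commute_sym/commuteV/commute_sym.
- exact/commuteV.
Qed.

Lemma hom_ev (theta : word V -> G) :
  (forall u v, raag_eq e u v -> theta u = theta v) ->
  (forall u v, theta (u ++ v) = theta u * theta v) ->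
  forall w, theta w = ev (theta \o gen) w.
Proof.
move=> cl mu; have t1 : theta [::] = 1.
  by apply: (mulgI (theta [::])); rewrite -mu mulg1.
elim=> [|[x b] w IH]; first by rewrite t1 ev_nil.
rewrite -cat1s mu IH ev_cat ev_cons ev_nil mulg1; congr (_ * _) => /=.
case: b => //; apply/esym/mulg1_eq; rewrite -mu -t1; apply: cl.
exact/rst_step/(@step_cancel _ _ [::] [::] (x, false)).
Qed.

End Evaluation.

(** * Exponent sums and retractions onto free groups of rank two *)

Section Exponents.
Variables (V : finType) (e : rel V).
Local Open Scope ring_scope.

(** The exponent sum of [z]. The free product over a one-point index set serves as a multiplicative
    copy of [int], so that the lemmas on [ev] apply. *)
Definition exps (z : V) (w : word V) : int :=
  abel tt (ev (fun v => syl tt ((v == z)%:R : int)) w).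

Lemma exps_cons z a w : exps z (a :: w) = (if a.1 == z then (-1) ^+ a.2 else 0) + exps z w.
Proof.
rewrite /exps ev_cons abelM; congr (_ + _).
by case: a => x [] /=; rewrite ?abelV abel_syl /=; case: (x == z).
Qed.

Lemma exps_gen z x : exps z (gen x) = (x == z)%:R.
Proof. by rewrite exps_cons /exps ev_nil abel1 addr0 /=; case: (x == z). Qed.

Lemma exps_class z u v : raag_eq e u v -> exps z u = exps z v.
Proof. by move=> uv; rewrite /exps (ev_class _ uv) // => x y _; apply: sylC. Qed.

Section Additive.
Variables (G : groupType) (M : zmodType) (eta : G -> M).
Hypothesis etaM : forall g h, eta (g * h)%g = eta g + eta h.

Lemma eta1 : eta 1%g = 0.
Proof. by apply: (addrI (eta 1%g)); rewrite -etaM mulg1 addr0. Qed.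

Lemma etaV g : eta (g^-1)%g = - eta g.
Proof. by apply/eqP; rewrite -addr_eq0 -etaM mulVg eta1. Qed.

(** A homomorphism to an abelian group factors through the exponent sums. *)
Lemma additive_ev gamma w : eta (ev gamma w) = \sum_z eta (gamma z) *~ exps z w.
Proof.
elim: w => [|[x b] w IH].
  by rewrite ev_nil eta1 big1 // => z _; rewrite /exps ev_nil abel1 mulr0z.
rewrite ev_cons etaM IH.
under [RHS]eq_bigr => z _ do rewrite exps_cons mulrzDr.
rewrite big_split /=; congr (_ + _); rewrite (bigD1 x) //= eqxx big1 ?addr0.
  by case: b; rewrite ?etaV ?expr1 ?expr0 ?mulrN1z ?mulr1z.
by move=> z /negPf zx; rewrite eq_sym zx mulr0z.
Qed.

End Additive.

Lemma ev_homE (G : groupType) (gamma : V -> G) phi :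
  (forall x y, e x y -> commute (gamma x) (gamma y)) -> raag_hom e phi ->
  forall w, ev gamma (phi w) = ev (fun x => ev gamma (phi (gen x))) w.
Proof.
move=> cg [phic phiM]; apply: (@hom_ev _ e _ (ev gamma \o phi)) => [u v /phic /(ev_class cg) //|u v].
by rewrite /= (ev_class cg (phiM u v)) ev_cat.
Qed.

Lemma ev_hom_commute (G : groupType) (gamma : V -> G) phi u v :
  (forall x y, e x y -> commute (gamma x) (gamma y)) -> raag_hom e phi -> e u v ->
  commute (ev gamma (phi (gen u))) (ev gamma (phi (gen v))).
Proof.
move=> cg [phic phiM] uv.
rewrite /commute -!ev_cat -(ev_class cg (phiM _ _)) -(ev_class cg (phiM _ _)).
by apply/(ev_class cg)/phic/rst_step; apply: (@step_comm _ _ [::] [::]).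
Qed.

(** The integers [exps z (phi (gen x))] thus form the matrix of [phi] on the abelianization. *)
Lemma exps_hom phi z w : raag_hom e phi ->
  exps z (phi w) = \sum_x exps z (phi (gen x)) * exps x w.
Proof.
move=> hphi; rewrite {1}/exps ev_homE //; last by move=> x y _; apply: sylC.
rewrite (additive_ev (abelM _)); apply: eq_bigr => x _.
by rewrite -mulrzr intz.
Qed.

(* The retraction of R_Gamma onto the free group <p, b>. *)
Definition retr2 (p b v : V) : fprod bool int :=
  if v == p then syl true 1 else if v == b then syl false 1 else 1%g.

Lemma retr2_commute p b : symmetric e -> irreflexive e -> p != b -> ~~ e p b ->
  forall x y, e x y -> commute (retr2 p b x) (retr2 p b y).
Proof.
move=> es ei pb npb x y xy; rewrite /retr2.
have nbp : ~~ e b p by rewrite es.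
case: (eqVneq x p) xy => [->|_] xy; case: (eqVneq y p) xy => [->|_] xy //.
- by case: (eqVneq y b) xy => [->|_ _]; [rewrite (negPf npb)|apply: commute1].
- by case: (eqVneq x b) xy => [->|_ _]; [rewrite (negPf nbp)|apply/commute_sym/commute1].
by case: (x == b); case: (y == b) => //; [apply: commute1|apply/commute_sym/commute1].
Qed.

Lemma abel_retr2 p b w : p != b ->
  abel true (ev (retr2 p b) w) = exps p w /\ abel false (ev (retr2 p b) w) = exps b w.
Proof.
move=> pb; have bp : b != p by rewrite eq_sym.
rewrite !(additive_ev (abelM _)); split.
  rewrite (bigD1 p) //= /retr2 eqxx abel_syl /= intz big1 ?addr0 // => z /negPf->.
  by case: eqP => _; rewrite ?abel1 ?abel_syl mul0rz.
rewrite (bigD1 b) //= /retr2 eqxx (negPf bp) abel_syl /= intz big1 ?addr0 // => z /negPf->.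
by case: eqP => _; rewrite ?abel1 ?abel_syl mul0rz.
Qed.

(** Commuting elements lie in a common conjugate of a factor or have proportional abelianizations;
    the determinant vanishes in both cases. *)
Lemma commute_abel_det (g h : fprod bool int) : commute g h ->
  abel true g * abel false h = abel false g * abel true h.
Proof.
have [->|g1] := eqVneq g 1%g; first by rewrite !abel1 !mul0r.
move=> c; case: (commute_trichotomy c g1) => [[k [i [m [n [_ -> ->]]]]]|[a [b [a0 H]]]].
  by rewrite !abelJ !abel_syl; case: i; rewrite ?mulr0 ?mul0r.
have a0' : a%:R != 0 :> int by rewrite pnatr_eq0 -lt0n.
have H' i : abel i h * a%:R = abel i g * b by rewrite mulr_natr H -mulrzr intz.
by apply: (mulIf a0'); rewrite -!mulrA !H' mulrCA.
Qed.

(** The images of [u] and [v] still commute after the retraction onto the free group on [p] and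
    [b]. *)
Lemma hom_exps_det phi p b u v : simple_graph e -> raag_hom e phi ->
  e u v -> p != b -> ~~ e p b ->
  exps p (phi (gen u)) * exps b (phi (gen v)) = exps b (phi (gen u)) * exps p (phi (gen v)).
Proof.
move=> [es ei] hphi uv pb npb.
have := commute_abel_det (ev_hom_commute (retr2_commute es ei pb npb) hphi uv).
by have [-> ->] := abel_retr2 (phi (gen u)) pb; have [-> ->] := abel_retr2 (phi (gen v)) pb.
Qed.

End Exponents.

(** * The action on the abelianization *)

Section AbelianizedAction.
Local Open Scope ring_scope.

(** A rank count for the system with unknowns in [S] and equations in [P]: a trivial kernel means
    rank [#|S|], and a square system of full rank is solvable. *)
Lemma injective_square_system (F : fieldType) (V : finType) (S P : {set V}) (A : V -> V -> F) :
  (forall c : V -> F, (forall d, d \in P -> \sum_(s in S) A d s * c s = 0) ->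
    forall s, s \in S -> c s = 0) ->
  (#|S| <= #|P|)%N /\
  (#|S| = #|P| -> forall d0, d0 \in P ->
    exists c : V -> F, forall d, d \in P -> \sum_(s in S) A d s * c s = (d == d0)%:R).
Proof.
move=> inj.
pose N : 'M[F]_(#|S|, #|P|) := \matrix_(i, j) A (enum_val j) (enum_val i).
(* At most one index contributes to this sum; it extends [u] by zero outside [S]. *)
pose ext (u : 'rV[F]_#|S|) s := \sum_(i | enum_val i == s) u 0 i.
have extE u i : ext u (enum_val i) = u 0 i.
  by rewrite /ext (big_pred1 i) // => k; rewrite /= (inj_eq enum_val_inj).
have mulE u j : (u *m N) 0 j = \sum_(s in S) A (enum_val j) s * ext u s.
  rewrite big_enum_val mxE; apply: eq_bigr => i _.
  by rewrite mxE extE mulrC.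
have freeN : row_free N.
  apply: inj_row_free => u uN; apply/rowP => i; rewrite mxE -extE.
  apply: inj (enum_valP i) => d dP.
  have := congr1 (fun M : 'rV_#|P| => M 0 (enum_rank_in dP d)) uN.
  by rewrite mulE mxE enum_rankK_in.
move: (freeN) => /eqP rN; split; first by rewrite -rN rank_leq_col.
move=> SP d0 d0P; have /row_fullP[B BN] : row_full N by rewrite /row_full rN SP.
exists (ext (row (enum_rank_in d0P d0) B)) => d dP.
have := mulE (row (enum_rank_in d0P d0) B) (enum_rank_in d0P d).
rewrite enum_rankK_in // => <-; rewrite -row_mul BN !mxE; congr (_%:R).
by rewrite -(inj_eq enum_val_inj) !enum_rankK_in // eq_sym.
Qed.

(** A non-zero determinant has a non-zero Leibniz term. Its permutation sends rows to columns, hence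
    the inverse in the choice of [pi]. *)
Lemma transversal_of_invertible (V : finType) (A B : V -> V -> int) :
  (forall x y, \sum_z A x z * B z y = (x == y)%:R) ->
  exists pi : {perm V}, forall v, A (pi v) v != 0.
Proof.
move=> AB.
pose mx (C : V -> V -> int) : 'M[int]_#|V| := \matrix_(i, j) C (enum_val i) (enum_val j).
have ABm : mx A *m mx B = 1%:M.
  apply/matrixP => i j; rewrite !mxE -(inj_eq enum_val_inj) -AB.
  rewrite (reindex (@enum_val V predT)) /=; last exact: onW_bij (@enum_val_bij V).
  by apply: eq_bigr => k _; rewrite !mxE.
have : \det (mx A) != 0.
  apply/eqP => dA; have := congr1 (fun M => \det M) ABm.
  by rewrite det_mulmx dA mul0r det1 => /eqP; rewrite eq_sym oner_eq0.
rewrite /determinant; have [s hs _|H] := pickP (fun s : 'S_#|V| => \prod_i mx A i (s i) != 0); last first.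
  rewrite big1 ?eqxx // => s _; have /negbFE/eqP -> := H s.
  by rewrite mulr0.
pose sg v : V := enum_val (s (enum_rank v)).
have sgI : injective sg by move=> u v /enum_val_inj /perm_inj /enum_rank_inj.
exists ((perm sgI)^-1)%g => v; set u := ((perm sgI)^-1)%g v.
have -> : v = sg u by rewrite -[sg u](permE sgI) permKV.
move/prodf_neq0: hs => /(_ (enum_rank u) isT).
by rewrite mxE enum_rankK.
Qed.

(** A permutation of a finite set has finite order, so its inverse is one of its powers and
    preserves the relation too. *)
Lemma perm_rel_mono (V : finType) (e : rel V) (pi : {perm V}) :
  (forall u v, e u v -> e (pi u) (pi v)) -> {mono pi : u v / e u v}.
Proof.
move=> H u v; apply/idP/idP => [|/H //] epuv.
have X k x y : e x y -> e ((pi ^+ k)%g x) ((pi ^+ k)%g y).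
  by elim: k x y => [|k IH] x y xy; rewrite ?expg0 ?perm1 // expgS !permM; apply/IH/H.
have K x : (pi ^+ #[pi]%g.-1)%g (pi x) = x.
  by rewrite -permM -expgS prednK ?order_gt0 // expg_order perm1.
by have := X #[pi]%g.-1 _ _ epuv; rewrite !K.
Qed.

(** * Without domination the matrix of an automorphism is a signed permutation matrix *)

Section Monomial.
Variables (V : finType) (e : rel V).
Hypothesis (se : simple_graph e).
Hypothesis nodom : forall x y : V, x != y -> ~~ (lk e x \subset st e y).
Variables A B : V -> V -> int.
Hypothesis AB : forall x y, \sum_z A x z * B z y = (x == y)%:R.
Hypothesis BA : forall x y, \sum_z B x z * A z y = (x == y)%:R.
Hypothesis Adet : forall u v p b, e u v -> p != b -> ~~ e p b ->
  A p u * A b v = A b u * A p v.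

Lemma in_st x y : (y \in st e x) = (y == x) || e x y.
Proof. by rewrite /st /lk !inE. Qed.

Let col_rel j s p b : s \in st e j -> p != b -> ~~ e p b -> A p j * A b s = A b j * A p s.
Proof.
rewrite in_st => /orP[/eqP->|js pb npb]; first by rewrite mulrC.
exact: Adet.
Qed.

(** Coordinate [b] of a combination of the columns of [A] indexed by [st e j]. By [col_rel] each of
    these columns satisfies the minor relations with the column [j], hence so does the combination.
    Rational coefficients make linear algebra available. *)
Let comb j (c : V -> rat) b : rat := \sum_(s in st e j) (A b s)%:~R * c s.

Let comb_rel j c p b : p != b -> ~~ e p b ->
  (A p j)%:~R * comb j c b = (A b j)%:~R * comb j c p.
Proof.
move=> pb npb; rewrite /comb !mulr_sumr; apply: eq_bigr => s sj.
by rewrite !mulrA -!rmorphM /= (col_rel sj pb npb).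
Qed.

Let comb_out j p c b : A p j != 0 -> b \notin st e p -> comb j c p = 0 -> comb j c b = 0.
Proof.
rewrite in_st negb_or => Apj /andP[bp npb] cp.
have pb : p != b by rewrite eq_sym.
have := comb_rel j c pb npb; rewrite cp mulr0 => /eqP.
by rewrite mulf_eq0 intr_eq0 (negPf Apj) /= => /eqP.
Qed.

(** Coordinate [p] is zero, so the coordinates outside [st e p] vanish by [comb_out]; the inverse
    matrix [B] then recovers [c]. *)
Let comb_inj j p c : A p j != 0 -> (forall d, d \in st e p -> comb j c d = 0) ->
  forall s, s \in st e j -> c s = 0.
Proof.
move=> Apj c0 s sj.
have {c0} c0 b : comb j c b = 0.
  have [|bp] := boolP (b \in st e p); first exact: c0.
  by apply: (comb_out Apj bp); apply: c0; rewrite in_st eqxx.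
have : \sum_b (B s b)%:~R * comb j c b = c s.
  under eq_bigr do rewrite /comb mulr_sumr.
  rewrite exchange_big /= (bigD1 s) //= [X in X + _](_ : _ = c s).
    rewrite big1 ?addr0 // => t /andP[_ /negPf ts].
    under eq_bigr do rewrite mulrA -rmorphM.
    by rewrite -mulr_suml -rmorph_sum /= BA eq_sym ts mul0r.
  under eq_bigr do rewrite mulrA -rmorphM.
  by rewrite -mulr_suml -rmorph_sum /= BA eqxx mul1r.
by move=> <-; rewrite big1 // => b _; rewrite c0 mulr0.
Qed.

Lemma monomial_of_no_domination : exists pi : {perm V},
  [/\ {mono pi : u v / e u v}, forall z v, z != pi v -> A z v = 0 &
      forall v, A (pi v) v = 1 \/ A (pi v) v = -1].
Proof.
have [pi piA] := transversal_of_invertible AB.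
have sys j := injective_square_system (fun c => @comb_inj j (pi j) c (piA j)).
(* There is an inequality for each vertex, and [pi] permutes the summands: the totals agree, so
   every inequality is an equality. *)
have card_st j : #|st e j| = #|st e (pi j)|.
  have L k : (#|st e k| <= #|st e (pi k)| ?= iff (#|st e k| == #|st e (pi k)|))%N.
    by split=> //; have [] := sys k.
  have [_] := leqif_sum (fun k (_ : true) => L k).
  rewrite -(reindex_inj (@perm_inj _ pi) (P := predT) (F := fun k => #|st e k|)) eqxx.
  by move/esym/forallP/(_ j) => /eqP.
have mono z v : A z v != 0 -> z = pi v.
  move=> Azv; apply/eqP; apply: contraT; rewrite eq_sym => /nodom/negP[].
  apply/subsetP => d; rewrite inE => pd.
  have dst : d \in st e (pi v) by rewrite in_st pd orbT.
  (* The square system is solved for the unit vector at [d] on [st e (pi v)]. Its coordinate at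
     [pi v] is zero, which forces zeros outside the star, so the combination is the unit vector at
     [d] everywhere. *)
  have [c cE] := (sys v).2 (card_st v) d dst.
  have dp : d != pi v by apply: contraTneq pd => ->; rewrite se.2.
  have cp : comb v c (pi v) = 0.
    by rewrite /comb cE ?in_st ?eqxx // eq_sym (negPf dp).
  have h b : comb v c b = (b == d)%:R.
    have [bp|bp] := boolP (b \in st e (pi v)); first exact: cE.
    rewrite (comb_out (piA v) bp cp); case: eqP => // bd.
    by rewrite bd dst in bp.
  rewrite in_st; apply: contraT; rewrite negb_or => /andP[dz nzd].
  have zd : z != d by rewrite eq_sym.
  (* For non-adjacent [z] and [d] the relation reads [A z v * 1 = A d v * 0], against the choice of
     [z]. *)
  have := comb_rel v c zd nzd; rewrite !h eqxx (negPf zd) mulr0 mulr1 => /eqP.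
  by rewrite intr_eq0 (negPf Azv).
have A0 z v : z != pi v -> A z v = 0.
  by move=> zv; apply/eqP; apply: contraNT zv => /mono ->.
exists pi; split => //.
  apply: perm_rel_mono => u v uv; apply: contraT => npuv.
  have uv' : u != v by apply: contraTneq uv => ->; rewrite se.2.
  have puv : pi u != pi v by rewrite (inj_eq perm_inj).
  (* The minor of a non-adjacent pair would force the product of the two non-zero entries
     [A (pi u) u] and [A (pi v) v] to vanish. *)
  have := Adet uv puv npuv; rewrite (A0 (pi v) u) 1?eq_sym // mul0r => /eqP.
  by rewrite mulf_eq0 !(negPf (piA _)).
move=> v; have := AB (pi v) (pi v); rewrite eqxx (bigD1 v) //= big1 ?addr0.
  move/(congr1 absz); rewrite abszM => /eqP; rewrite muln_eq1 => /andP[/eqP].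
  by case: (A (pi v) v) => [n /= ->|[] // _ _]; [left|right].
by move=> z zv; rewrite A0 ?mul0r // (inj_eq perm_inj) eq_sym.
Qed.

End Monomial.

End AbelianizedAction.

(** * Automorphisms and retractions onto free groups *)

Section Retractions.
Local Open Scope group_scope.

Lemma morph_ev (V : finType) (G H : groupType) (F : G -> H) (gamma : V -> G) w :
  (forall g h, F (g * h) = F g * F h) -> F (ev gamma w) = ev (F \o gamma) w.
Proof.
move=> FM; have F1 : F 1 = 1 by apply: (mulgI (F 1)); rewrite -FM !mulg1.
elim: w => [|[x b] w IH]; first by rewrite !ev_nil.
rewrite !ev_cons FM IH; congr (_ * _); case: b => //=.
by apply/esym/mulg1_eq; rewrite -FM mulgV.
Qed.

Lemma eq_ev (V : finType) (G : groupType) (gamma delta : V -> G) w :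
  gamma =1 delta -> ev gamma w = ev delta w.
Proof. by move=> E; apply: eq_bigr => a _; rewrite E. Qed.

(** * Projections that kill the link of a vertex *)

Section StarProjection.
Variables (V : finType) (e : rel V).
Hypothesis se : simple_graph e.

Definition delta (v : V) : {ffun V -> int} := [ffun z => (z == v)%:R%R].

(* The target is the free product of <x> and the free abelian group on the
   complement of st(x). *)
Definition star_proj (x v : V) : fprod bool {ffun V -> int} :=
  if v == x then syl true (delta x) else if e x v then 1 else syl false (delta v).

Lemma star_proj_commute x u v : e u v -> commute (star_proj x u) (star_proj x v).
Proof.
rewrite /star_proj => uv.
case: (eqVneq u x) uv => [->|_] uv; case: (eqVneq v x) uv => [->|_] uv //.
- by rewrite uv; apply: commute1.
- by rewrite se.1 uv; apply/commute_sym/commute1.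
case: (e x u); case: (e x v); try exact: commute1; try exact/commute_sym/commute1.
exact: sylC.
Qed.

(* For [i = false] the two factors are exchanged. *)
Definition coord_lift (i : bool) (x y : V) : fprod bool {ffun V -> int} -> fprod bool int :=
  lift_fp (fun j (m : {ffun V -> int}) => if j then syl i (m x) else syl (~~ i) (m y)).

Lemma coord_liftD i x y j (m n : {ffun V -> int}) :
  (if j then syl i ((m + n)%R x) else syl (~~ i) ((m + n)%R y)) =
  (if j then syl i (m x) else syl (~~ i) (m y)) * (if j then syl i (n x) else syl (~~ i) (n y))
  :> fprod bool int.
Proof. by case: j; rewrite ffunE sylD. Qed.

Lemma coord_liftM i x y g h :
  coord_lift i x y (g * h) = coord_lift i x y g * coord_lift i x y h.
Proof. exact/lift_fpM/coord_liftD. Qed.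

Lemma coord_liftJ i x y g k :
  coord_lift i x y (g ^ k) = coord_lift i x y g ^ coord_lift i x y k.
Proof.
rewrite !conjgE !coord_liftM; congr (_ * _).
by apply/esym/mulg1_eq; rewrite -coord_liftM mulgV /coord_lift lift_fp1.
Qed.

Lemma coord_lift_syl i x y j m :
  coord_lift i x y (syl j m) = if j then syl i (m x) else syl (~~ i) (m y).
Proof. exact/lift_syl/coord_liftD. Qed.

(** The retraction onto the free group on two non-adjacent vertices factors through the star
    projection at either of them; [i] records which generator of the free group [x] becomes. *)
Lemma coord_lift_star i x y v : x != y -> ~~ e x y ->
  coord_lift i x y (star_proj x v) = if i then retr2 x y v else retr2 y x v.
Proof.
move=> xy nxy; have yx : y != x by rewrite eq_sym.
rewrite /star_proj /retr2; have [->|nvx] := eqVneq v x.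
  by rewrite coord_lift_syl ffunE eqxx (negPf xy); case: i.
case: ifP => xv.
  have nvy : v != y by apply: contraTneq xv => ->.
  by rewrite /coord_lift lift_fp1 (negPf nvy); case: i.
rewrite coord_lift_syl ffunE eq_sym; case: (eqVneq v y) => _; case: i => //=; exact: syl0.
Qed.

Lemma coord_lift_ev i x y w : x != y -> ~~ e x y ->
  coord_lift i x y (ev (star_proj x) w) = ev (if i then retr2 x y else retr2 y x) w.
Proof.
move=> xy nxy; rewrite morph_ev; last exact: coord_liftM.
by apply: eq_ev => v; rewrite /= coord_lift_star //; case: i.
Qed.

End StarProjection.

Lemma retr2_surj (V : finType) (x y : V) : x != y ->
  forall g, exists w, ev (retr2 x y) w = g.
Proof.
move=> xy; have yx : y != x by rewrite eq_sym.
apply: fprod_ind => [|i m g [w <-]]; first by exists [::]; apply: ev_nil.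
suff [u <-] : exists u, ev (retr2 x y) u = syl i m by exists (u ++ w); apply: ev_cat.
have [u Eu] : exists u, ev (retr2 x y) u = syl i 1%R.
  by case: i; [exists (gen x)|exists (gen y)]; rewrite ev_gen /retr2 eqxx ?(negPf yx).
case: m => n; last exists (inv_word (flatten (nseq n.+1 u))).
  by exists (flatten (nseq n u)); rewrite ev_flatten Eu -sylX; congr syl; rewrite natz.
by rewrite ev_inv_word ev_flatten Eu -sylX -sylN; congr syl; rewrite NegzE natz.
Qed.

(** * The effect of an automorphism on the retractions *)

Section Automorphism.
Variables (V : finType) (e : rel V).
Hypothesis se : simple_graph e.
Hypothesis nodom : forall x y : V, x != y -> ~~ (lk e x \subset st e y).
Variable phi : word V -> word V.
Hypothesis aphi : raag_aut e phi.

Lemma aut_exps : exists (pi : {perm V}) (eps : V -> int),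
  [/\ {mono pi : u v / e u v}, forall v, eps v = 1%R \/ eps v = (-1)%R &
      forall z v, exps z (phi (gen v)) = if z == pi v then eps v else 0%R].
Proof.
have [hphi [psi [hpsi [psiK phiK]]]] := aphi.
pose A (f : word V -> word V) (z x : V) : int := exps z (f (gen x)).
have inv f g : raag_hom e f -> (forall w, raag_eq e (f (g w)) w) -> forall x y,
    (\sum_z A f x z * A g z y = (x == y)%:R)%R.
  move=> hf fK x y; rewrite /A -(exps_hom x (g (gen y)) hf).
  by rewrite (exps_class x (fK _)) exps_gen eq_sym.
have [pi [pm A0 A1]] := monomial_of_no_domination se nodom (inv _ _ hphi phiK)
  (inv _ _ hpsi psiK) (fun u v p b uv pb npb => hom_exps_det se hphi uv pb npb).
exists pi, (fun v => A phi (pi v) v); split=> // z v.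
by have [->|zv] := eqVneq z (pi v); last exact: A0.
Qed.

Section Monomial.
Variables (pi : {perm V}) (eps : V -> int).
Hypothesis pim : {mono pi : u v / e u v}.
Hypothesis eps1 : forall v, eps v = 1%R \/ eps v = (-1)%R.
Hypothesis expsE : forall z v, exps z (phi (gen v)) = if z == pi v then eps v else 0%R.

Let hphi : raag_hom e phi := aphi.1.

Let eps0 v : eps v != 0%R. Proof. by case: (eps1 v) => ->. Qed.

Lemma abel_phi (M : zmodType) (gamma : V -> fprod bool M) i v :
  abel i (ev gamma (phi (gen v))) = (abel i (gamma (pi v)) *~ eps v)%R.
Proof.
rewrite (additive_ev (abelM _)) (bigD1 (pi v)) //= expsE eqxx big1 ?addr0 // => z /negPf zv.
by rewrite expsE zv mulr0z.
Qed.

(* Some neighbour u of v is also mapped outside the star of x. In the free product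
   the images of u and v commute and have independent abelianizations, so they lie
   in a common conjugate of the abelian factor. *)
Lemma star_proj_conj x v : pi v \notin st e x ->
  exists k, ev (star_proj e x) (phi (gen v)) = syl false (delta (pi v) *~ eps v)%R ^ k.
Proof.
move=> vx; set x' := (pi^-1)%g x; have Ex : x = pi x' by rewrite permKV.
(* [lk e v] is not contained in the star of the preimage of [x], and [pi] preserves adjacency. *)
have [u vu ux] : exists2 u, e v u & pi u \notin st e x.
  have vx' : v != x' by apply: contraNneq vx => ->; rewrite Ex in_st eqxx.
  have /subsetPn[u] := nodom vx'; rewrite inE => vu ux; exists u => //.
  by move: ux; rewrite !in_st Ex (inj_eq perm_inj) pim.
have star_false z : z \notin st e x -> star_proj e x z = syl false (delta z).
  by rewrite in_st negb_or /star_proj => /andP[/negPf-> /negPf->].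
have c := ev_hom_commute (@star_proj_commute _ _ se x) hphi vu.
have av := abel_phi (star_proj e x) false v; have au := abel_phi (star_proj e x) false u.
rewrite star_false // abel_syl /= in av; rewrite star_false // abel_syl /= in au.
have deltaE z t (n : int) : (delta z *~ n)%R t = ((t == z)%:R * n)%R.
  by rewrite ffunMzE ffunE -mulrzr intz.
have av0 : abel false (ev (star_proj e x) (phi (gen v))) != 0%R.
  apply/eqP => /ffunP/(_ (pi v)); rewrite av deltaE eqxx mul1r ffunE; exact/eqP.
have [|[k [i [m [n [_ Ev _]]]]]|[a [b [a0 /(_ false)]]]] := commute_trichotomy c.
- by apply: contraNneq av0 => ->; rewrite abel1.
- exists k; rewrite Ev; rewrite Ev abelJ abel_syl in av av0.
  by case: i av av0 {Ev} => /=; [rewrite eqxx|move=> ->].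
(* In the proportional case the coordinate at [pi u] says that [a] copies of [eps u] add up to zero,
   because [pi u] and [pi v] differ. *)
rewrite au av => /ffunP/(_ (pi u)); rewrite ffunMnE !ffunMzE !ffunE eqxx intz.
have -> : (pi u == pi v) = false.
  by rewrite (inj_eq perm_inj); apply: contraTF vu => /eqP->; rewrite se.2.
rewrite !mul0rz => /eqP; rewrite mulrn_eq0 (negPf (eps0 u)) orbF.
by rewrite -leqn0 leqNgt a0.
Qed.

(** A vertex sent outside the star of [x] is controlled by the star projection at [x], which leaves
    a conjugate of a power of the generator [y]; the same holds with the roles exchanged. The
    preimages of [y] and [x] are of these two kinds. A vertex sent into the link of [x] has an image
    that commutes with a conjugate of the generator [x] or its inverse. *)
Lemma retr2_phi_conj x y : x != y -> ~~ e x y ->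
  exists k l, forall v, ev (retr2 x y) (phi (gen v)) =
    if pi v == x then syl true (eps v) ^ k
    else if pi v == y then syl false (eps v) ^ l else 1.
Proof.
move=> xy nxy; have yx : y != x by rewrite eq_sym.
have nyx : ~~ e y x by rewrite se.1.
have outx v : pi v \notin st e x -> exists k, ev (retr2 x y) (phi (gen v)) =
    syl false (if pi v == y then eps v else 0%R) ^ k.
  case/star_proj_conj=> k /(congr1 (coord_lift true x y)).
  rewrite coord_lift_ev // coord_liftJ coord_lift_syl /= ffunMzE ffunE => ->.
  by eexists; congr (syl _ _ ^ _); rewrite eq_sym; case: eqP => _; rewrite ?intz ?mul0rz.
have outy v : pi v \notin st e y -> exists k, ev (retr2 x y) (phi (gen v)) =
    syl true (if pi v == x then eps v else 0%R) ^ k.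
  case/star_proj_conj=> k /(congr1 (coord_lift false y x)).
  rewrite coord_lift_ev // coord_liftJ coord_lift_syl /= ffunMzE ffunE => ->.
  by eexists; congr (syl _ _ ^ _); rewrite eq_sym; case: eqP => _; rewrite ?intz ?mul0rz.
set x' := (pi^-1)%g x; have Ex : pi x' = x by rewrite permKV.
set y' := (pi^-1)%g y; have Ey : pi y' = y by rewrite permKV.
have [|k Ek] := outy x'; first by rewrite Ex in_st negb_or xy.
have [|l El] := outx y'; first by rewrite Ey in_st negb_or yx.
exists k, l => v.
have [vx|vx] := eqVneq (pi v) x.
  have -> : v = x' by apply: (@perm_inj _ pi); rewrite vx Ex.
  by rewrite Ek Ex eqxx.
have [vy|vy] := eqVneq (pi v) y.
  have -> : v = y' by apply: (@perm_inj _ pi); rewrite vy Ey.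
  by rewrite El Ey eqxx.
have [|nvx] := boolP (pi v \in st e x); last first.
  by have [k' ->] := outx v nvx; rewrite (negPf vy) syl0 conj1g.
rewrite in_st (negPf vx) /= -Ex pim => vx'.
(* the image of v centralizes a generator up to conjugation, and has trivial abelianization *)
have := ev_hom_commute (retr2_commute se.1 se.2 xy nxy) hphi vx'.
rewrite Ek Ex eqxx => /(commute_conj k^-1); rewrite conjgK => /(cent_syl (eps0 x'))[n].
move/(canRL (conjgKV _)) => En.
have := abel_phi (retr2 x y) true v; rewrite En abelJ abel_syl /= /retr2 (negPf vx) (negPf vy).
by rewrite abel1 mul0rz => ->; rewrite syl0 conj1g.
Qed.

(** Both [phi] and the retraction are surjective, so the two conjugated factors generate the free
    group and a common conjugator exists. *)
Lemma retr2_phi x y : x != y -> ~~ e x y ->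
  exists c, forall v, ev (retr2 x y) (phi (gen v)) =
    (if pi v == x then syl true (eps v) else if pi v == y then syl false (eps v) else 1) ^ c.
Proof.
move=> xy nxy; have [k [l H]] := retr2_phi_conj xy nxy.
have [|g|c Hc] := @conj_factors_generate int k l.
- by exists 1%R.
- have [w <-] := retr2_surj xy g.
  have [_ [psi [_ [_ /(_ w) phiK]]]] := aphi.
  have cc := retr2_commute se.1 se.2 xy nxy.
  rewrite -(ev_class cc phiK) (ev_homE cc hphi).
  elim: (psi w) => [|[v b] u IH]; first by exists [::]; rewrite ev_nil big_nil.
  have E i n h : (exists t, h = \prod_(s <- t) syl s.1 s.2 ^ (if s.1 then k else l)) ->
      exists t, syl i n ^ (if i then k else l) * h =
        \prod_(s <- t) syl s.1 s.2 ^ (if s.1 then k else l) :> fprod bool int.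
    by case=> t' ->; exists ((i, n) :: t'); rewrite big_cons.
  rewrite ev_cons; move: (ev _ u) IH => h Hh; rewrite /= H; case: (pi v == x).
    by case: b; rewrite -?conjVg -?sylN; apply: (E true).
  case: (pi v == y); last by case: b; rewrite ?invg1 mul1g.
  by case: b; rewrite -?conjVg -?sylN; apply: (E false).
exists c => v; rewrite H; case: (_ == x); first by case: (Hc (eps v)).
by case: (_ == y); [case: (Hc (eps v))|rewrite conj1g].
Qed.

End Monomial.
End Automorphism.

End Retractions.

(** * Quasimorphisms *)

Local Open Scope R_scope.

Lemma bounded_multiples (r C : R) : (forall n : nat, Rabs (INR n * r) <= C) -> r = 0.
Proof.
move=> H; have [//|r0] := Req_dec r 0; exfalso.
have pr : 0 < Rabs r by apply: Rabs_pos_lt.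
have [n Hn] := INR_unbounded (C / Rabs r).
have := H n; rewrite Rabs_mult (Rabs_pos_eq (INR n)); last exact: pos_INR.
move/(Rmult_lt_compat_r _ _ _ pr): Hn.
by rewrite /Rdiv Rmult_assoc Rinv_l; lra.
Qed.

(** * Homogenization of a quasimorphism *)

Section Homogenization.
Variables (G : groupType) (q : G -> R) (D : R).
Hypothesis qD : forall g h : G, Rabs (q g + q h - q (g * h)%g) <= D.

Lemma quasi_expg (g : G) n : Rabs (q (g ^+ n)%g - INR n * q g) <= (INR n + 1) * D.
Proof.
elim: n => [|n IH].
  by have := qD 1%g 1%g; rewrite mulg1 expg0 /=; split_Rabs; lra.
have : Rabs (q (g ^+ n)%g + q g - q (g ^+ n.+1)%g) <= D by rewrite expgSr; apply: qD.
by rewrite S_INR; move: IH; split_Rabs; lra.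
Qed.

Lemma quasi_bound_ge0 : 0 <= D.
Proof. by have := qD 1%g 1%g; split_Rabs; lra. Qed.

(** Both terms are compared with [q (g ^+ (n * m))]. *)
Lemma quasi_expg2 (g : G) m n :
  INR m * q (g ^+ n)%g - INR n * q (g ^+ m)%g <= (INR m + INR n + 2) * D.
Proof.
have : Rabs (q (g ^+ (n * m))%g - INR m * q (g ^+ n)%g) <= (INR m + 1) * D.
  by rewrite expgnA; apply: quasi_expg.
have : Rabs (q (g ^+ (n * m))%g - INR n * q (g ^+ m)%g) <= (INR n + 1) * D.
  by rewrite mulnC expgnA; apply: quasi_expg.
by split_Rabs; lra.
Qed.

Definition lower_slopes (g : G) (r : R) :=
  exists n : nat, r = (q (g ^+ n.+1)%g - 2 * D) / INR n.+1.

(** Every lower slope lies below every upper slope, so the supremum of the lower ones has the right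
    distance from all of them. *)
Lemma lower_slopes_le g n r : lower_slopes g r ->
  r <= (q (g ^+ n.+1)%g + 2 * D) / INR n.+1.
Proof.
move=> [m ->]; have pm : 0 < INR m.+1 by apply: lt_0_INR; apply/ltP.
have pn : 0 < INR n.+1 by apply: lt_0_INR; apply/ltP.
apply: (Rmult_le_reg_r (INR m.+1 * INR n.+1)); first exact: Rmult_lt_0_compat.
replace ((q (g ^+ m.+1)%g - 2 * D) / INR m.+1 * (INR m.+1 * INR n.+1))
  with (INR n.+1 * q (g ^+ m.+1)%g - 2 * D * INR n.+1) by (field; lra).
replace ((q (g ^+ n.+1)%g + 2 * D) / INR n.+1 * (INR m.+1 * INR n.+1))
  with (INR m.+1 * q (g ^+ n.+1)%g + 2 * D * INR m.+1) by (field; lra).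
have := quasi_expg2 g n.+1 m.+1; have D0 := quasi_bound_ge0.
have := pos_INR m; have := pos_INR n; rewrite !S_INR => *.
have := Rmult_le_pos _ _ (pos_INR m) D0; have := Rmult_le_pos _ _ (pos_INR n) D0; lra.
Qed.

Lemma lower_slopes_bound g : bound (lower_slopes g).
Proof. by exists ((q (g ^+ 1)%g + 2 * D) / INR 1) => r; apply: lower_slopes_le. Qed.

Lemma lower_slopes_nonempty g : exists r, lower_slopes g r.
Proof. by exists ((q (g ^+ 1)%g - 2 * D) / INR 1), 0%N. Qed.

(* This is the limit of q (g ^+ n) / n; the slopes with error term bound it from below. *)
Definition homogenization (g : G) : R :=
  proj1_sig (completeness _ (lower_slopes_bound g) (lower_slopes_nonempty g)).

Lemma homogenizationP g n : Rabs (q (g ^+ n)%g - INR n * homogenization g) <= 2 * D.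
Proof.
have D0 := quasi_bound_ge0.
case: n => [|n]; first by have := quasi_expg g 0; rewrite /=; split_Rabs; lra.
rewrite /homogenization; case: completeness => r [ub lub] /=.
have pn : 0 < INR n.+1 by apply: lt_0_INR; apply/ltP.
have h1 := ub _ (ex_intro _ n erefl).
have h2 : r <= (q (g ^+ n.+1)%g + 2 * D) / INR n.+1.
  by apply: lub => s; apply: lower_slopes_le.
move/(Rmult_le_compat_l _ _ _ (Rlt_le _ _ pn)): h1.
move/(Rmult_le_compat_l _ _ _ (Rlt_le _ _ pn)): h2.
replace (INR n.+1 * ((q (g ^+ n.+1)%g + 2 * D) / INR n.+1)) with (q (g ^+ n.+1)%g + 2 * D)
  by (field; lra).
replace (INR n.+1 * ((q (g ^+ n.+1)%g - 2 * D) / INR n.+1)) with (q (g ^+ n.+1)%g - 2 * D)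
  by (field; lra).
by move: (INR n.+1 * r) => t; split_Rabs; lra.
Qed.

(** Two numbers of this kind have a difference with bounded multiples, hence coincide. The
    identities for powers, inverses, conjugates and endomorphisms are reduced to this criterion. *)
Lemma homogenization_unique g r C :
  (forall n, Rabs (q (g ^+ n)%g - INR n * r) <= C) -> homogenization g = r.
Proof.
move=> H; apply: Rminus_diag_uniq; apply: (@bounded_multiples _ (C + 2 * D)) => n.
have := H n; have := homogenizationP g n; rewrite Rmult_minus_distr_l.
by split_Rabs; lra.
Qed.

Lemma homogenization_near g : Rabs (q g - homogenization g) <= 2 * D.
Proof. by have := homogenizationP g 1; rewrite expg1 Rmult_1_l. Qed.

Lemma homogenizationX g m : homogenization (g ^+ m)%g = INR m * homogenization g.
Proof.
apply: (homogenization_unique (C := 2 * D)) => n; rewrite -expgnA -Rmult_assoc -mult_INR.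
by rewrite multE mulnC; apply: homogenizationP.
Qed.

Lemma homogenizationV g : homogenization g^-1%g = - homogenization g.
Proof.
apply: (homogenization_unique (C := 4 * D)) => n.
have h1 : Rabs (q (g ^+ n)%g + q (g^-1 ^+ n)%g - q 1%g) <= D.
  by rewrite expVgn -(mulgV (g ^+ n)%g); apply: qD.
have h2 : Rabs (q 1%g) <= D by have := qD 1%g 1%g; rewrite mulg1; split_Rabs; lra.
have tri (a b c x : R) : Rabs (a + b - c) <= D -> Rabs c <= D -> Rabs (a - x) <= 2 * D ->
    Rabs (b + x) <= 4 * D by split_Rabs; lra.
rewrite /Rminus -Ropp_mult_distr_r Ropp_involutive.
exact: tri h1 h2 (homogenizationP g n).
Qed.

Lemma homogenizationJ g k : homogenization (g ^ k)%g = homogenization g.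
Proof.
apply: (homogenization_unique (C := 4 * D + Rabs (q k) + Rabs (q (k^-1)%g))) => n.
have h1 : Rabs (q (k^-1)%g + q (g ^+ n * k)%g - q ((g ^ k) ^+ n)%g) <= D.
  by rewrite -conjXg conjgE; apply: qD.
have h2 : Rabs (q (g ^+ n)%g + q k - q (g ^+ n * k)%g) <= D by apply: qD.
have tri (a b c d p x : R) : Rabs (a + b - c) <= D -> Rabs (d + p - b) <= D ->
  Rabs (d - x) <= 2 * D -> Rabs (c - x) <= 4 * D + Rabs p + Rabs a by split_Rabs; lra.
exact: tri h1 h2 (homogenizationP g n).
Qed.

(** The constant consists of the defect [D] and an error [2 * D] for each of the three values. *)
Lemma homogenization_quasi g h :
  Rabs (homogenization g + homogenization h - homogenization (g * h)%g) <= 7 * D.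
Proof.
have := homogenization_near g; have := homogenization_near h.
have := homogenization_near (g * h)%g; have := qD g h.
by split_Rabs; lra.
Qed.

Lemma homogenization_morph (s : G -> G) g :
  (forall g h, s (g * h)%g = (s g * s h)%g) -> (forall g, q (s g) = q g) ->
  homogenization (s g) = homogenization g.
Proof.
move=> sM qs; apply: (homogenization_unique (C := 2 * D)) => n.
have -> : ((s g) ^+ n = s (g ^+ n))%g.
  elim: n => [|n IH]; last by rewrite !expgS sM IH.
  by rewrite !expg0; apply: (mulgI (s 1%g)); rewrite -sM !mulg1.
by rewrite qs; apply: homogenizationP.
Qed.

End Homogenization.

(** * Weighted counts of adjacent syllables *)

Section AdjacentPairs.
Variables (I : choiceType) (M : zmodType) (kappa : I * M -> I * M -> R).
Hypothesis kappaC : forall s t, kappa t s = - kappa s t.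
Hypothesis kappa_le1 : forall s t, Rabs (kappa s t) <= 1.
Hypothesis kappaV : forall s t, kappa (invs s) (invs t) = kappa s t.

Fixpoint adj (w : seq (I * M)) : R :=
  if w is s :: w' then (if w' is t :: _ then kappa s t else 0) + adj w' else 0.

Lemma adj_cons s w : Rabs (adj (s :: w) - adj w) <= 1.
Proof.
rewrite /=; case: w => [|t w] /=; first by split_Rabs; lra.
by have := kappa_le1 s t; split_Rabs; lra.
Qed.

Lemma adj_cat u v : Rabs (adj (u ++ v) - adj u - adj v) <= 1.
Proof.
elim: u => [|s u IH] /=; first by split_Rabs; lra.
case: u IH => [|t u] /= IH; last by move: IH; split_Rabs; lra.
by have := adj_cons s v; rewrite /=; split_Rabs; lra.
Qed.

Lemma adj_rcons2 u s t : adj (rcons (rcons u s) t) = adj (rcons u s) + kappa s t.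
Proof. by elim: u => [|r u IH] /=; [|case: u IH => [|r' u] /= IH]; lra. Qed.

(** Inversion reverses the order of each adjacent pair, and [kappa] is antisymmetric and blind to
    signs. *)
Lemma adj_invw u : adj (invw u) = - adj u.
Proof.
elim: u => [|s [|t u] IH]; first by rewrite /=; lra.
  by rewrite /invw /=; lra.
rewrite !invw_cons adj_rcons2 -invw_cons IH kappaC kappaV /=; lra.
Qed.

(** The contributions of the cancelled word and its inverse are opposite. Cutting the three words at
    the junction and dropping one syllable from each costs at most 1 each time, whence 6. *)
Lemma adj_quasi (g h : fprod I M) :
  Rabs (adj g + adj h - adj (fpval (g * h)%g)) <= 6.
Proof.
have [u [c [v H]]] := mulw_decomp (fpvalP g) (fpvalP h).
have tri (X Y Z a b d s t r : R) : Rabs (X - a - s) <= 1 -> Rabs (Y - - b - t) <= 1 ->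
  Rabs (Z - a - r) <= 1 -> Rabs (s - b) <= 1 -> Rabs (t - d) <= 1 -> Rabs (r - d) <= 1 ->
  Rabs (X + Y - Z) <= 6 by split_Rabs; lra.
have H0 (x : R) : Rabs (x - x) <= 1 by split_Rabs; lra.
have cat_inv w : Rabs (adj (invw c ++ w) - - adj c - adj w) <= 1.
  by rewrite -adj_invw; apply: adj_cat.
rewrite fpvalM; case: H => [[-> -> ->]|[i [m [n [-> -> ->]]]]].
  exact: tri (adj_cat _ _) (cat_inv _) (adj_cat _ _) (H0 _) (H0 _) (H0 _).
by apply: tri (adj_cat _ _) (cat_inv _) (adj_cat _ _) _ _ _; apply: adj_cons.
Qed.

End AdjacentPairs.

HB.instance Definition _ := Monoid.isComLaw.Build R 0 Rplus
  (fun x y z => esym (Rplus_assoc x y z)) Rplus_comm Rplus_0_l.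

(** * The quasimorphisms on the free group and elements that separate them *)

Section SyllablePattern.

Definition pattern_hit (N : nat) (s t : bool * int) : R :=
  if [&& ~~ s.1, absz s.2 == 1%N, t.1 & absz t.2 == N] then 1 else 0.

(* Only absolute values of exponents enter, so the resulting count ignores
   inversions of the generators. *)
Definition pattern_weight N (s t : bool * int) := pattern_hit N s t - pattern_hit N t s.

Lemma pattern_weightC N s t : pattern_weight N t s = - pattern_weight N s t.
Proof. by rewrite /pattern_weight; lra. Qed.

Lemma pattern_weight_le1 N s t : Rabs (pattern_weight N s t) <= 1.
Proof.
by rewrite /pattern_weight /pattern_hit; do 2 case: ifP => _; split_Rabs; lra.
Qed.

Lemma pattern_weightV N s t : pattern_weight N (invs s) (invs t) = pattern_weight N s t.
Proof. by rewrite /pattern_weight /pattern_hit /= !abszN. Qed.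

Definition pattern_qm N : fprod bool int -> R :=
  homogenization (adj_quasi (pattern_weightC N) (pattern_weight_le1 N) (@pattern_weightV N)).

Section Flip.
Variable c : bool -> int.
Hypothesis c1 : forall i, c i = 1%R \/ c i = (-1)%R.

Lemma flipD i (m n : int) :
  syl i (c i * (m + n))%R = (syl i (c i * m)%R * syl i (c i * n)%R)%g :> fprod bool int.
Proof. by rewrite mulrDr sylD. Qed.

(** The automorphism of the free group that inverts the generators with [c i = -1]. *)
Definition flip : fprod bool int -> fprod bool int :=
  lift_fp (fun i (m : int) => syl i (c i * m)%R).

Lemma flipM g h : flip (g * h)%g = (flip g * flip h)%g.
Proof. exact/lift_fpM/flipD. Qed.

Lemma fpval_flip (g : fprod bool int) :
  fpval (flip g) = [seq (s.1, (c s.1 * s.2)%R) | s <- fpval g].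
Proof.
have c0 i n : ((c i * n)%R == 0%R) = (n == 0%R).
  by case: (c1 i) => ->; rewrite ?mul1r // mulN1r oppr_eq0.
case: g => w r; rewrite /flip /lift_fp /=; elim: w r => [|s w IH] r.
  by rewrite /liftw big_nil.
rewrite /liftw big_cons fpval_sylM [fpval (\big[_/_]_(_ <- _) _)]IH ?(reduced_behead r) //.
rewrite push_red //; move: r; rewrite /reduced /= c0 => /andP[/andP[-> h1]] h2.
rewrite all_map /= path_map; apply/andP; split => //.
by apply: sub_all h1 => t /=; rewrite c0.
Qed.

Lemma adj_flip N (g : fprod bool int) :
  adj (pattern_weight N) (flip g) = adj (pattern_weight N) g.
Proof.
have cabs i n : absz (c i * n)%R = absz n.
  by case: (c1 i) => ->; rewrite ?mul1r // mulN1r abszN.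
rewrite fpval_flip; elim: (fpval g) => //= s w ->; congr (_ + _); case: w => //= t w.
by rewrite /pattern_weight /pattern_hit /= !cabs.
Qed.

Lemma pattern_qm_flip N g : pattern_qm N (flip g) = pattern_qm N g.
Proof. by apply: homogenization_morph => [g' h|g']; [apply: flipM|apply: adj_flip]. Qed.

End Flip.

Lemma pattern_qm_syl N i m : pattern_qm N (syl i m) = 0.
Proof.
apply: (@homogenization_unique _ _ _ _ _ _ 0) => n; rewrite -sylX fpval_syl.
by case: ifP => _ /=; split_Rabs; lra.
Qed.

(** With $x$ for [true] and $y$ for [false], the block for [b = true] is $x^{j+3} y^2 x y$. In its
    powers a pair $(y^1, x^N)$ with $N \ge 3$ occurs only between consecutive blocks, for $N = j+3$,
    and $(x^N, y^1)$ never occurs because of the separating $y^2$. For [b = false] the exponents of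
    $x$ are 1 and 2, so nothing is counted. *)
Definition witness_block (b : bool) (j : nat) : seq (bool * int) :=
  [:: (b, Posz j.+3); (~~ b, 2%R); (b, 1%R); (~~ b, 1%R)].

Definition witness_elt b j : fprod bool int :=
  (syl b (Posz j.+3) * syl (~~ b) 2%R * syl b 1%R * syl (~~ b) 1%R)%g.

Lemma fpval_witnessX b j n :
  fpval (witness_elt b j ^+ n)%g = flatten (nseq n (witness_block b j)).
Proof.
elim: n => [|n IH] //=; rewrite expgS; move: (_ ^+ n)%g IH => g IH.
rewrite /witness_elt -!mulgA !fpval_sylM IH.
by case: b {IH}; case: n.
Qed.

Lemma pattern_qm_witness b j i :
  pattern_qm i.+3 (witness_elt b j) = if b && (i == j) then 1 else 0.
Proof.
apply: (@homogenization_unique _ _ _ _ _ _ 1) => n; rewrite fpval_witnessX.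
set d := (X in INR n * X); have d1 : 0 <= d <= 1 by rewrite /d; case: ifP => _; lra.
have hitE s t : pattern_weight i.+3 s t = 
  (if [&& ~~ s.1, absz s.2 == 1%N, t.1 & absz t.2 == i.+3] then 1 else 0) -
  (if [&& ~~ t.1, absz t.2 == 1%N, s.1 & absz s.2 == i.+3] then 1 else 0) by [].
case: n => [|n]; first by rewrite /=; split_Rabs; lra.
(* There are only [n] junctions between [n.+1] blocks; the error bound 1 absorbs the missing one. *)
suff -> : adj (pattern_weight i.+3) (flatten (nseq n.+1 (witness_block b j))) = INR n * d.
  by rewrite S_INR; split_Rabs; lra.
elim: n => [|n IH]; first by case: b @d d1 => d d1; rewrite /= !hitE /=; lra.
rewrite S_INR; move: IH; set w := flatten (nseq n.+1 _) => IH.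
have -> : flatten (nseq n.+2 (witness_block b j)) = witness_block b j ++ w by [].
have Ew : w = (b, Posz j.+3) :: behead w by [].
rewrite {1}Ew; move: (behead w) Ew => w' Ew; move: IH; rewrite Ew {w Ew}.
have adj2 s t v : adj (pattern_weight i.+3) (s :: t :: v) =
  pattern_weight i.+3 s t + adj (pattern_weight i.+3) (t :: v) by [].
rewrite /witness_block !cat_cons cat0s !adj2 => ->.
rewrite !hitE /d; case: b {d d1} => /=; last lra.
by rewrite !eqSS eq_sym; case: eqP => _; lra.
Qed.

End SyllablePattern.

Lemma sum_quasi (T : Type) (r : seq T) (P : pred T) (D : R) (a b c : T -> R) :
  (forall p, Rabs (a p + b p - c p) <= D) ->
  Rabs (\big[Rplus/0]_(p <- r | P p) a p + \big[Rplus/0]_(p <- r | P p) b p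
        - \big[Rplus/0]_(p <- r | P p) c p) <= \big[Rplus/0]_(p <- r | P p) D.
Proof.
move=> H; elim: r => [|p r IH]; first by rewrite !big_nil; split_Rabs; lra.
rewrite !big_cons; case: ifP => _ //.
by have := H p; move: IH; split_Rabs; lra.
Qed.

(** * Summation over non-adjacent pairs *)

Section PairSum.
Variables (V : finType) (e : rel V).

(** The pattern distinguishes the two generators, so the sum runs over ordered pairs; graph
    automorphisms permute these. *)
Definition pair_sum N (w : word V) : R :=
  \big[Rplus/0]_(p : V * V | (p.1 != p.2) && ~~ e p.1 p.2) pattern_qm N (ev (retr2 p.1 p.2) w).

Lemma pair_sum_quasi N : simple_graph e -> quasimorphism e (pair_sum N).
Proof.
move=> [es ei]; split=> [u v uv|].
  apply: eq_bigr => p /andP[p12 np12]; congr pattern_qm.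
  exact: ev_class (retr2_commute es ei p12 np12) _ _ uv.
eexists=> u v; apply: sum_quasi => p.
by rewrite ev_cat; apply: homogenization_quasi.
Qed.

Lemma pair_sum_homogeneous N : homogeneous (pair_sum N).
Proof.
have mul_sum (P : pred (V * V)) x (a : V * V -> R) :
    \big[Rplus/0]_(p | P p) (x * a p) = x * \big[Rplus/0]_(p | P p) a p.
  apply/esym/(big_morph (Rmult x)); [exact: Rmult_plus_distr_l|exact: Rmult_0_r].
have X m w (p : V * V) : pattern_qm N (ev (retr2 p.1 p.2) (flatten (nseq m w))) =
    INR m * pattern_qm N (ev (retr2 p.1 p.2) w).
  by rewrite ev_flatten; apply: homogenizationX.
move=> w z; rewrite /pair_sum -mul_sum; apply: eq_bigr => p _; case: z => [|k|k] /=.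
- by rewrite ev_nil -(syl0 _ true) pattern_qm_syl; lra.
- by rewrite X INR_IPR.
- rewrite X ev_inv_word INR_IPR -/(IZR (Z.pos k)).
  have -> : pattern_qm N (ev (retr2 p.1 p.2) w)^-1%g = - pattern_qm N (ev (retr2 p.1 p.2) w).
    exact: homogenizationV.
  by rewrite -Pos2Z.opp_pos opp_IZR; lra.
Qed.

Lemma pair_sum_aut N : simple_graph e ->
  (forall x y : V, x != y -> ~~ (lk e x \subset st e y)) -> aut_invariant e (pair_sum N).
Proof.
move=> se nodom phi aphi w.
have [pi [eps [pim eps1 expsE]]] := aut_exps se nodom aphi.
have pattern_qmE x y : x != y -> ~~ e x y ->
    pattern_qm N (ev (retr2 (pi x) (pi y)) (phi w)) = pattern_qm N (ev (retr2 x y) w).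
  move=> xy nxy; have pxy : pi x != pi y by rewrite (inj_eq perm_inj).
  have npxy : ~~ e (pi x) (pi y) by rewrite pim.
  (* Applying [phi] and retracting to the images of [x] and [y] amounts to retracting to [x] and
     [y], flipping signs and conjugating by [c]. *)
  have [c H] := retr2_phi se nodom aphi pim eps1 expsE pxy npxy.
  rewrite (ev_homE (retr2_commute se.1 se.2 pxy npxy) aphi.1) (eq_ev _ H).
  rewrite -(morph_ev (F := fun g => g ^ c)%g); last by move=> g h; apply: conjMg.
  rewrite [LHS]homogenizationJ -/(pattern_qm N _).
  pose s (i : bool) := if i then eps x else eps y.
  have s1 i : s i = 1%R \/ s i = (-1)%R by case: i; apply: eps1.
  rewrite -(pattern_qm_flip s1 N (ev (retr2 x y) w)) morph_ev; last exact: flipM.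
  congr pattern_qm; apply: eq_ev => v; rewrite /= /retr2 !(inj_eq perm_inj) /flip.
  have [->|_] := eqVneq v x; first by rewrite lift_syl ?mulr1 //; apply: flipD.
  have [->|_] := eqVneq v y; first by rewrite lift_syl ?mulr1 //; apply: flipD.
  by rewrite lift_fp1.
rewrite /pair_sum (reindex (fun p : V * V => (pi p.1, pi p.2))) /=; last first.
  exists (fun p : V * V => ((pi^-1)%g p.1, (pi^-1)%g p.2)) => -[x y] _ /=.
    by rewrite !permK.
  by rewrite !permKV.
apply: eq_big => [p|p /andP[p12 np12]]; first by rewrite (inj_eq perm_inj) pim.
by apply: pattern_qmE; [rewrite (inj_eq perm_inj) in p12|rewrite pim in np12].
Qed.

Definition witness_word (x y : V) j : word V :=
  flatten (nseq j.+3 (gen x)) ++ gen y ++ gen y ++ gen x ++ gen y.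

Lemma ev_witness (G : groupType) (gamma : V -> G) x y j :
  ev gamma (witness_word x y j) =
  (gamma x ^+ j.+3 * gamma y ^+ 2 * gamma x * gamma y)%g.
Proof. by rewrite /witness_word ev_cat ev_flatten !ev_cat !ev_gen expg2 !mulgA. Qed.

(** The pair [(x, y)] gives the value of the witness for [true], and the reversed pair that of the
    witness for [false], which is zero. Any other pair kills [x] or [y] and leaves a power of one
    generator. *)
Lemma pair_sum_witness x y i j : x != y -> ~~ e x y -> ~~ e y x ->
  pair_sum i.+3 (witness_word x y j) = if i == j then 1 else 0.
Proof.
move=> xy nxy nyx; have yx : y != x by rewrite eq_sym.
have sylXn b n : (syl b 1 ^+ n)%g = syl b (Posz n) :> fprod bool int by rewrite -sylX natz.
rewrite /pair_sum (bigD1 (x, y)) /=; last by rewrite xy.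
rewrite big1 => [|[u v] /= /andP[/andP[uv nuv] uvxy]].
  rewrite ev_witness /retr2 eqxx (negPf yx) eqxx !sylXn [pattern_qm _ _]pattern_qm_witness /=; lra.
rewrite ev_witness; have [/eqP[-> ->]|uvyx] := boolP ((u, v) == (y, x)).
  by rewrite /retr2 eqxx (negPf xy) eqxx !sylXn [pattern_qm _ _]pattern_qm_witness.
have syl_of z : exists b m, retr2 u v z = syl b m.
  rewrite /retr2; case: eqP => _; first by exists true, 1%R.
  by case: eqP => _; [exists false, 1%R|exists true, 0%R; rewrite syl0].
have [Ex|Ey] : retr2 u v x = 1%g \/ retr2 u v y = 1%g.
  move: uvxy uvyx uv; rewrite /retr2 !xpair_eqE.
  rewrite ![x == _]eq_sym ![y == _]eq_sym.
  have [->|ux] := eqVneq u x; have [->|vx] := eqVneq v x => //=; try by left.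
    by rewrite (negPf xy) => /negPf-> _ _; right.
  by rewrite (negPf xy) andbT => _ /negPf-> _; right.
- have [b [m ->]] := syl_of y; rewrite Ex expg1n mul1g mulg1 -expgSr -sylX; exact: pattern_qm_syl.
- have [b [m ->]] := syl_of x; rewrite Ey expg1n !mulg1 -expgSr -sylX; exact: pattern_qm_syl.
Qed.

End PairSum.

Theorem theorem1p2 (V : finType) (e : rel V) :
  simple_graph e ->
  (2 <= #|V|)%N ->
  (forall x y : V, x != y -> ~~ (lk e x \subset st e y)) ->
  exists F : nat -> word V -> R,
    (forall i, quasimorphism e (F i) /\ homogeneous (F i) /\ aut_invariant e (F i)) /\
    lin_indep_seq F.
Proof.
move=> se V2 nodom; exists (fun i => pair_sum e i.+3); split=> [i|].
  split; first exact: pair_sum_quasi.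
  by split; [apply: pair_sum_homogeneous|apply: pair_sum_aut].
have [x [y [xy nxy]]] : exists x y, x != y /\ ~~ e x y.
  have /card_gt1P[x [y [_ _ xy]]] : (1 < #|[set: V]|)%N by rewrite cardsT.
  (* A neighbour of [x] outside the star of [y] forms a non-adjacent pair with [y]. *)
  have /subsetPn[z _] := nodom x y xy; rewrite in_st negb_or => /andP[zy nyz].
  by exists y, z; rewrite eq_sym.
have nyx : ~~ e y x by rewrite se.1.
(* The witness words are dual to the functions: evaluation at the one with index [i] isolates
   [c i]. *)
move=> n c H i ltin; rewrite -(H (witness_word x y i)) (bigD1 (Ordinal ltin)) //=.
rewrite pair_sum_witness // eqxx big1 => [|k ki]; first by lra.
rewrite pair_sum_witness //; case: eqP => [Ek|_]; last by lra.
by case/eqP: ki; apply: val_inj.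
Qed.
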